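(* Let $m\ge3$ be an integer, let $\omega$ be a complex number with $\omega^m=1$, and let $p$ be a real number with $1<p<2^{1/(4m)}$ such that $p^{2m}$ is different from the second Pisot number. Set $q:=p\omega$. Then every interior point (in $\mathbb C$) of the set $(p^m-1)J_q=\{(p^m-1)x: x\in J_q\}$ has a universal expansion in base $q$.
   Context: For a complex number $q$ with $|q|>1$, an expansion of a complex number $z$ in base $q$ is a sequence $(c_k)_{k\ge1}$ with $c_k\in\{0,1\}$ such that $\sum_{k=1}^\infty c_k q^{-k}=z$. $J_q$ denotes the set of complex numbers having at least one expansion in base $q$. An expansion is universal if the sequence contains every finite block of zeroes and ones as a block of consecutive terms. The second Pisot number is the second smallest Pisot number, $\approx1.3803$, the real root greater than $1$ of $x^4-x^3-1$. *)

(* Defs.v *)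
From HB Require Import structures.
From mathcomp Require Import all_boot all_order all_algebra.
From mathcomp Require Import complex.
From mathcomp Require Import all_classical all_reals all_analysis.

Set Implicit Arguments.
Unset Strict Implicit.
Unset Printing Implicit Defensive.

Import Order.TTheory GRing.Theory Num.Theory.
Import numFieldNormedType.Exports.

Local Open Scope classical_set_scope.
Local Open Scope ring_scope.
Local Open Scope complex_scope.

(* The topology on [R[i]] is the one induced by the complex modulus; it is
   carried by the alias [R[i]^o], which is convertible to [R[i]]. *)

(* Digit sequences are indexed from 0: [c k] is the digit of weight
   [q^-(k+1)], i.e. the (k+1)-st digit in the usual numbering. *)
Definition expansion (R : realType) (q : R[i]) (c : nat -> bool) (z : R[i]) :
    Prop :=
  series (fun k : nat => (c k)%:R * q ^- k.+1 : R[i]^o) @ \oo --> (z : R[i]^o).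

Definition expandable (R : realType) (q : R[i]) : set R[i]^o :=
  [set z | exists c, expansion q c z].

Definition universal (c : nat -> bool) : Prop :=
  forall b : seq bool, exists n : nat,
    forall i : nat, (i < size b)%N -> c (n + i)%N = nth false b i.

(* [P] is the minimal polynomial of the algebraic integer [x], so its complex
   roots are the conjugates of [x]. *)
Definition pisot (R : realType) : set R :=
  [set x | 1 < x /\
    exists P : {poly int},
      [/\ P \is monic,
          irreducible_poly (map_poly intr P : {poly rat}),
          root (map_poly intr P) x &
          forall z : R[i], root (map_poly intr P) z -> z != x%:C ->
            `|z| < 1]].

Definition least (R : realType) (A : set R) (x : R) : Prop :=
  A x /\ lbound A x.

Definition second_pisot (R : realType) (x : R) : Prop :=
  exists2 x1 : R, least (@pisot R) x1 & least (@pisot R `\ x1) x.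

(* Main.v *)
Require Import Defs.
From HB Require Import structures.
From mathcomp Require Import all_boot all_order all_algebra.
From mathcomp Require Import polyorder complex.
From mathcomp Require algebraics_fundamentals.
From mathcomp Require Import all_classical all_reals all_analysis.
From mathcomp Require Import zify ring lra.

(** Put Q = p^m, so that q^m = Q, 1 < Q and Q^4 < 2.  Grouping the digits by
    their position modulo m, the interior points of (Q - 1) J_q are sums of
    t_j q^j over j < m with all t_j in ]0,1[.  A finite word of length m L acts
    on each coordinate t_j separately, by a word of length L in base Q, so it
    suffices to steer all coordinates simultaneously through prescribed blocks.
    This is possible as soon as the numbers y(Q), for y a polynomial with
    coefficients 0 and 1, have gaps tending to 0 at infinity.

    Exponents divisible by 4 already give gaps at most 1, because Q^4 < 2; hence
    it is enough to find arbitrarily small nonzero differences a(Q) - b(Q) with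
    exponents of a and b not divisible by 4.  Otherwise these values are
    separated.  For a conjugate al of Q, the map y(Q) |-> y(al) is then, up to a
    bounded error, an additive function f on the half-line with
    f(Qx) = al f(x) + O(1); if al <> Q this forces f to be bounded, and so
    |al| < 1.  Thus Q would be a Pisot number smaller than 2^(1/4).  Smyth's
    argument excludes this: for the minimal polynomial P of Q and its reciprocal
    P^*, the power series P/P^* has integer coefficients, while multiplying it
    by (1 - Qz)/(z - Q) gives a Blaschke product, whose squared coefficients sum
    to at most 1.  This leaves only a constant P/P^*, that is P = P(0) P^*; but
    then 1/Q is the only possible root of P besides Q, and 0 < |P(1)| < 1. *)

Set Implicit Arguments.
Unset Strict Implicit.
Unset Printing Implicit Defensive.

Import Order.TTheory GRing.Theory Num.Theory.
Import numFieldNormedType.Exports ComplexField.Normc.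

Local Open Scope classical_set_scope.
Local Open Scope ring_scope.
Local Open Scope complex_scope.

Lemma exists_lt_exprn (R : realType) (a x : R) : 1 < a -> exists n, x < a ^+ n.
Proof.
move=> a1; have a0 : 0 < a by exact: lt_trans a1.
have /cvgrPdist_lt/(_ (1 + `|x|)^-1) : (GRing.exp a^-1 : R ^nat) @ \oo --> 0.
  by apply: cvg_expr; rewrite gtr0_norm ?invr_gt0 // invf_lt1.
have x1 : 0 < 1 + `|x| by rewrite ltr_pwDl.
rewrite invr_gt0 => /(_ x1)[n _ /(_ n (leqnn n))] /=.
rewrite sub0r normrN exprVn gtr0_norm ?invr_gt0 ?exprn_gt0 //.
rewrite ltf_pV2 ?posrE ?exprn_gt0 // => xn; exists n.
by apply: le_lt_trans xn; rewrite ler_wpDl // ler_norm.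
Qed.

Lemma ltr_expr_powR_inv (R : realType) (x a : R) n : 0 <= x -> 0 <= a ->
  (0 < n)%N -> x < a `^ n%:R^-1 -> x ^+ n < a.
Proof.
move=> x0 a0 n0 xa; have -> : a = (a `^ n%:R^-1) ^+ n.
  by rewrite -powR_mulrn ?powR_ge0 // -powRrM mulVf ?powRr1 // pnatr_eq0 -lt0n.
by rewrite ltrXn2r -?lt0n // ?nnegrE ?powR_ge0.
Qed.

Lemma ler_of_natmulD (R : archiRealFieldType) (a b c : R) :
  (forall n : nat, a * n%:R <= b * n%:R + c) -> a <= b.
Proof.
move=> abc; rewrite leNgt; apply/negP => ba.
have := archi_boundP (normr_ge0 (c / (a - b))); set n := Num.bound _.
move=> /(le_lt_trans (ler_norm _)); rewrite ltr_pdivrMr ?subr_gt0 // => cn.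
have := abc n; move: cn; rewrite mulrBr; lra.
Qed.

Section Normc.
Variable R : rcfType.
Implicit Types (z w : R[i]) (x : R).

Lemma normr_normc z : `|z| = (normc z)%:C.
Proof. by []. Qed.

Lemma normc_ge0 z : 0 <= normc z.
Proof. exact: (@normr_ge0 _ (Rcomplex R)). Qed.

Lemma normcX z n : normc (z ^+ n) = normc z ^+ n.
Proof.
by elim: n => [|n IH]; [exact: normc1|rewrite !exprS normcM IH].
Qed.

Lemma normc_real x : normc x%:C = `|x|.
Proof. by rewrite /= expr0n addr0 sqrtr_sqr. Qed.

Lemma sqr_normcE z : normc z ^+ 2 = complex.Re z ^+ 2 + complex.Im z ^+ 2.
Proof. by case: z => a b; rewrite sqr_sqrtr // addr_ge0 // sqr_ge0. Qed.

Lemma normcD_le z w a b :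
  normc z <= a -> normc w <= b -> normc (z + w) <= a + b.
Proof. by move=> za wb; apply: le_trans (le_normcD _ _) (lerD za wb). Qed.

Lemma normcB_le z w a b :
  normc z <= a -> normc w <= b -> normc (z - w) <= a + b.
Proof. by move=> za wb; apply: normcD_le => //; rewrite normcN. Qed.

Lemma normc_sum_le (I : Type) (r : seq I) (F : I -> R[i]) (b : I -> R) :
  (forall i, normc (F i) <= b i) ->
  normc (\sum_(i <- r) F i) <= \sum_(i <- r) b i.
Proof.
move=> Fb; elim/big_ind2: _ => [|z a w b' za wb|i _]; rewrite ?normc0 //.
exact: normcD_le.
Qed.

Lemma normc_parallelogram z w :
  normc (z + w) ^+ 2 + normc (z - w) ^+ 2 = 2 * (normc z ^+ 2 + normc w ^+ 2).
Proof. by case: z w => [a b] [c d]; rewrite !sqr_normcE /=; ring. Qed.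

Lemma normc_int_ge1 (n : int) : n != 0 -> 1 <= normc (n%:~R : R[i]).
Proof.
rewrite -(rmorph_int (real_complex R)) normc_real -intr_norm ler1z.
by rewrite -gtz0_ge1 normr_gt0.
Qed.

Lemma gt0_complex (e : R[i]) : 0 < e -> exists2 r : R, e = r%:C & 0 < r.
Proof. by case: e => a b; rewrite ltcE /= => /andP[/eqP -> a0]; exists a. Qed.

End Normc.

(** * Polynomials with coefficients 0 and 1 *)

Definition evalz (F : comNzRingType) (x : F) (y : {poly int}) : F :=
  (map_poly intr y).[x].

HB.instance Definition _ (F : comNzRingType) (x : F) :=
  GRing.RMorphism.copy (evalz x) (horner_eval x \o map_poly intr).

Section Evalz.
Variables (F G : comNzRingType).
Implicit Types (x : F) (y : {poly int}).

Lemma evalzX x : evalz x 'X = x.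
Proof. by rewrite /evalz map_polyX hornerX. Qed.

Lemma evalzXn x n : evalz x 'X^n = x ^+ n.
Proof. by rewrite rmorphXn /= evalzX. Qed.

Lemma evalz_comp x y y' : evalz x (y \Po y') = evalz (evalz x y') y.
Proof. by rewrite /evalz map_comp_poly horner_comp. Qed.

Lemma rmorph_evalz (f : {rmorphism F -> G}) x y : f (evalz x y) = evalz (f x) y.
Proof.
rewrite /evalz -horner_map -map_poly_comp; congr (_.[_]).
by apply: eq_map_poly => i /=; rewrite rmorph_int.
Qed.

Lemma evalz_coef_wide x y n : (size y <= n)%N ->
  evalz x y = \sum_(i < n) (y`_i)%:~R * x ^+ i.
Proof.
move=> yn; rewrite /evalz (horner_coef_wide x (leq_trans (size_poly _ _) yn)).
by apply: eq_bigr => i _; rewrite coef_map.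
Qed.

End Evalz.

Lemma size_polyDXn (F : nzSemiRingType) (p : {poly F}) n : (size p <= n)%N ->
  size (p + 'X^n) = n.+1.
Proof. by move=> pn; rewrite addrC size_polyDl size_polyXn. Qed.

Definition digit_poly (S : pred nat) (y : {poly int}) : Prop :=
  forall i, y`_i = 0 \/ S i /\ y`_i = 1.

Section DigitPoly.
Implicit Types (S : pred nat) (y : {poly int}).

Lemma digit_poly0 S : digit_poly S 0.
Proof. by move=> i; left; rewrite coef0. Qed.

Lemma digit_polyS S S' y :
  {subset S <= S'} -> digit_poly S y -> digit_poly S' y.
Proof. by move=> SS' Sy i; case: (Sy i) => [->|[/SS' ? ->]]; [left|right]. Qed.

Lemma digit_poly_below S y n : (size y <= n)%N ->
  digit_poly S y -> digit_poly (fun i => S i && (i < n)%N) y.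
Proof.
move=> yn Sy i; case: (ltnP i n) => ni.
  by case: (Sy i) => [->|[Si ->]]; [left|right; rewrite Si].
by left; rewrite nth_default // (leq_trans yn).
Qed.

Lemma digit_polyD S S' y y' : (forall i, S i -> ~~ S' i) ->
  digit_poly S y -> digit_poly S' y' ->
  digit_poly (fun i => S i || S' i) (y + y').
Proof.
move=> SS' Sy S'y' i; rewrite coefD.
case: (Sy i) => [->|[Si ->]]; case: (S'y' i) => [->|[S'i ->]].
- by left.
- by right; rewrite S'i orbT.
- by right; rewrite Si.
- by have := SS' i Si; rewrite S'i.
Qed.

Lemma digit_polyDXn S y n : S n -> (size y <= n)%N ->
  digit_poly S y -> digit_poly S (y + 'X^n).
Proof.
move=> Sn yn Sy i; rewrite coefD coefXn; case: eqP => [->|_].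
  by rewrite nth_default // add0r; right.
by rewrite addr0; exact: Sy.
Qed.

Lemma digit_polyXnM S S' n y : (forall i, S i -> S' (n + i)%N) ->
  digit_poly S y -> digit_poly S' ('X^n * y).
Proof.
move=> SS' Sy i; rewrite coefXnM; case: ltnP => ni; first by left.
case: (Sy (i - n)%N) => [->|[/SS' + ->]]; first by left.
by rewrite subnKC // => ?; right.
Qed.

Lemma digit_poly_comp_Xn S d y : (0 < d)%N -> digit_poly S y ->
  digit_poly (fun i => (d %| i)%N && S (i %/ d)%N) (y \Po 'X^d).
Proof.
move=> d0 Sy i; rewrite coef_comp_poly_Xn //.
by case: (d %| i)%N => /=; [exact: Sy|left].
Qed.

End DigitPoly.

Section DigitPolyValue.
Variables (R : realFieldType) (Q : R) (S : pred nat) (y : {poly int}).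
Hypotheses (Q1 : 1 < Q) (Sy : digit_poly S y).

Let term_ge0 i : 0 <= (y`_i)%:~R * Q ^+ i.
Proof.
have Q0 : 0 < Q by exact: lt_trans Q1.
by case: (Sy i) => [->|[_ ->]]; rewrite ?mul0r // mul1r exprn_ge0 // ltW.
Qed.

Lemma evalz_digit_ge0 : 0 <= evalz Q y.
Proof.
by rewrite (evalz_coef_wide Q (leqnn _)) sumr_ge0 // => i _; exact: term_ge0.
Qed.

Lemma ler_exprn_evalz i : y`_i != 0 -> Q ^+ i <= evalz Q y.
Proof.
move=> yi0.
have yi : y`_i = 1 by case: (Sy i) yi0 => [->|[_ ->]]; rewrite ?eqxx.
have iy : (i < size y)%N by rewrite ltnNge; apply: contra yi0 => /leq_sizeP ->.
rewrite (evalz_coef_wide Q (leqnn _)) (bigD1 (Ordinal iy)) //= yi mul1r lerDl.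
by apply: sumr_ge0 => j _; exact: term_ge0.
Qed.

Lemma size_digit_poly n : evalz Q y < Q ^+ n -> (size y <= n)%N.
Proof.
move=> yn; apply/leq_sizeP => i ni; apply/eqP; apply: contraLR yn => yi0.
by rewrite -leNgt (le_trans _ (ler_exprn_evalz yi0)) // ler_weXn2l // ltW.
Qed.

End DigitPolyValue.

Definition approx_below (R : numDomainType) (Q : R) (S : pred nat) (delta x : R)
    (y : {poly int}) : Prop :=
  digit_poly S y /\ evalz Q y <= x < evalz Q y + delta.

Lemma exists_greedy_approx (R : realType) (b x : R) : 1 < b -> b <= 2 ->
  0 <= x -> exists y, approx_below b xpredT 1 x y.
Proof.
move=> b1 b2 x0; have [n xn] := exists_lt_exprn x b1.
suff [y [_ y_approx]] : exists y : {poly int},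
    (size y <= n)%N /\ approx_below b xpredT 1 x y by exists y.
elim: n x x0 xn => [|n IH] x x0 xn.
  exists 0; rewrite size_poly0; split=> //; split; first exact: digit_poly0.
  by rewrite rmorph0 add0r x0.
have [xbn|bnx] := ltP x (b ^+ n).
  by have [y [yn y_approx]] := IH x x0 xbn; exists y; split=> //; exact: leqW.
have bn0 : 0 <= b ^+ n by rewrite exprn_ge0 // (le_trans ler01) // ltW.
have [||y [yn [y_digits y_x]]] := IH (x - b ^+ n); first by rewrite subr_ge0.
  by rewrite exprS in xn; have := ler_wpM2r bn0 b2; lra.
exists (y + 'X^n); rewrite size_polyDXn //; split=> //; split.
  exact: digit_polyDXn.
by rewrite rmorphD /= evalzXn; lra.
Qed.

Definition residue (d j : nat) : pred nat := fun i => i == j %[mod d].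

Lemma exists_residue_approx (R : realType) (Q : R) d j x :
  1 < Q -> Q ^+ d <= 2 -> (0 < d)%N -> 0 <= x ->
  exists y, approx_below Q (residue d j) (Q ^+ j) x y.
Proof.
move=> Q1 Qd d0 x0.
have Qj : 0 < Q ^+ j by rewrite exprn_gt0 // (lt_trans ltr01).
have [||y [y_digits y_x]] := @exists_greedy_approx R (Q ^+ d) (x / Q ^+ j) _ Qd.
- by rewrite exprn_egt1 // -lt0n.
- by rewrite divr_ge0 // ltW.
exists ('X^j * (y \Po 'X^d)); split.
  apply: digit_polyXnM (digit_poly_comp_Xn d0 y_digits) => i /andP[di _].
  by rewrite /residue -[in eqbRHS](addn0 j) eqn_modDl mod0n.
move: y_x; rewrite rmorphM /= evalz_comp !evalzXn ler_pdivlMr // ltr_pdivrMr //.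
by rewrite mulrDl mul1r mulrC.
Qed.

(** * Quasi-additive functions *)

Section QuasiAdditive.
Variables (R : realType) (f : R -> R[i]).

Definition quasi_additive (c : R) : Prop :=
  forall x y, 0 <= x -> 0 <= y -> normc (f (x + y) - f x - f y) <= c.

Definition locally_bounded : Prop :=
  forall x, exists b, forall y, 0 <= y <= x -> normc (f y) <= b.

Variable c : R.
Hypotheses (f_quasi_additive : quasi_additive c) (f_bounded : locally_bounded).

Lemma quasi_additive_natmul x n : 0 <= x ->
  normc (f (n%:R * x) - n%:R * f x) <= c * n.+1%:R.
Proof.
move=> x0; elim: n => [|n IH].
  have := f_quasi_additive (lexx 0) (lexx 0).
  by rewrite addr0 subrr sub0r normcN !mul0r subr0 mulr1.
have := f_quasi_additive (mulr_ge0 (ler0n _ n) x0) x0.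
rewrite (_ : n%:R * x + x = n.+1%:R * x); last by rewrite -natr1 mulrDl mul1r.
move=> /normcD_le/(_ IH); rewrite -(natr1 n.+1) mulrDr mulr1 [leRHS]addrC.
by congr (normc _ <= _); rewrite -(natr1 n); ring.
Qed.

Lemma quasi_additive_scale x : 0 <= x -> exists b, forall l, 0 <= l ->
  normc (f (l * x) - l%:C * f x) <= c * l + b.
Proof.
move=> x0; have [b fb] := f_bounded x.
exists (c + c + (b + normc (f x))) => l l0.
have c0 : 0 <= c by apply: le_trans (f_quasi_additive x0 x0); exact: normc_ge0.
have /andP[kl lk] := truncn_itv l0; set k := Num.truncn l in kl lk *.
set r := (l - k%:R) * x.
have r0 : 0 <= r by rewrite mulr_ge0 // subr_ge0.
have rx : r <= x by rewrite ler_piMl // lerBlDl natr1 ltW.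
have split_l := f_quasi_additive (mulr_ge0 (ler0n _ k) x0) r0.
have nat_part := quasi_additive_natmul k x0.
have frac_part : normc (f r - (l - k%:R)%:C * f x) <= b + normc (f x).
  apply: normcB_le; first by apply: fb; rewrite r0.
  rewrite normcM normc_real ler_piMl ?normc_ge0 // ger0_norm ?subr_ge0 //.
  by rewrite lerBlDl natr1 ltW.
have := normcD_le (normcD_le split_l nat_part) frac_part.
have -> : k%:R * x + r = l * x by rewrite /r; ring.
have -> : f (l * x) - f (k%:R * x) - f r + (f (k%:R * x) - k%:R * f x)
    + (f r - (l - k%:R)%:C * f x) = f (l * x) - l%:C * f x.
  by rewrite rmorphB rmorph_nat; ring.
have := ler_wpM2l c0 kl; rewrite -(natr1 k); lra.
Qed.

(* Additivity gives f (Q n x) ~ Q n f(x), while the scaling relation gives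
   f (Q n x) ~ al n f(x): both errors are linear in n, uniformly in x. *)
Lemma quasi_additive_bounded (Q c' : R) (al : R[i]) : 0 < Q -> al != Q%:C ->
  (forall x, 0 <= x -> normc (f (Q * x) - al * f x) <= c') ->
  exists b, forall x, 0 <= x -> normc (f x) <= b.
Proof.
move=> Q0 alQ f_scale.
have d0 : 0 < normc (al - Q%:C).
  rewrite lt_neqAle normc_ge0 andbT eq_sym; apply: contra alQ => /eqP.
  by move=> /eq0_normc /eqP; rewrite subr_eq0.
exists (c * (normc al + Q) / normc (al - Q%:C)) => x x0; rewrite ler_pdivlMr //.
have [b fb] := quasi_additive_scale x0.
apply: (ler_of_natmulD (c := c' + b * normc al + b)) => n.
have n0 : 0 <= n%:R :> R by exact: ler0n.
have by_scaling := f_scale _ (mulr_ge0 n0 x0).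
have by_additivity := fb _ (mulr_ge0 (ltW Q0) n0).
have := ler_wpM2l (normc_ge0 al) (fb _ n0); rewrite -normcM => at_n.
have := normcB_le (normcB_le by_additivity by_scaling) at_n.
have -> : f (Q * n%:R * x) - (Q * n%:R)%:C * f x
    - (f (Q * (n%:R * x)) - al * f (n%:R * x))
    - al * (f (n%:R * x) - n%:R%:C * f x) = (al - Q%:C) * n%:R%:C * f x.
  by rewrite rmorphM mulrA; ring.
by rewrite !normcM normc_real (ger0_norm n0); lra.
Qed.

End QuasiAdditive.

(** * Conjugates of a base with separated digit sums *)

Lemma interval_buckets (R : realType) (eta L : R) : 0 < eta ->
  exists n, forall x0, exists bucket : R -> 'I_n.+1,
    forall x y, x0 <= x <= x0 + L -> x0 <= y <= x0 + L ->
      bucket x = bucket y -> `|x - y| < eta.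
Proof.
move=> eta0; exists (Num.truncn (L / eta)) => x0.
exists (fun x => inord (Num.truncn ((x - x0) / eta))) => x y xL yL.
have bucketP z : x0 <= z <= x0 + L -> let k := Num.truncn ((z - x0) / eta) in
    (k < (Num.truncn (L / eta)).+1)%N /\ k%:R * eta <= z - x0 < k.+1%:R * eta.
  move=> /andP[zl zu] /=; split.
    by rewrite ltnS le_truncn // ler_pM2r ?invr_gt0 //; lra.
  rewrite -ler_pdivlMr // -ltr_pdivrMr // truncn_itv //.
  by rewrite divr_ge0 ?subr_ge0 // ltW.
have [kx xk] := bucketP _ xL; have [ky yk] := bucketP _ yL.
move=> /(congr1 val); rewrite /= !inordK // => kxy; move: xk yk.
rewrite kxy; move: (Num.truncn _) => k.
by rewrite -(natr1 k) mulrDl mul1r ltr_norml; lra.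
Qed.

Lemma infinite_set_injection (T : pointedType) (A : set T) : infinite_set A ->
  exists2 v : nat -> T, injective v & forall n, A (v n).
Proof.
move=> /infiniteP/ppcard_leP[v]; exists v => [i j|n]; last exact: funS.
by apply: inj; rewrite inE.
Qed.

Lemma finite_set_normc_bounded (R : rcfType) (A : set R[i]) : finite_set A ->
  exists M, forall z, A z -> normc z <= M.
Proof.
move=> /finite_seqP[s ->]; exists (\sum_(z <- s) normc z) => z /= zs.
by rewrite (big_rem z) //= lerDl sumr_ge0 // => w _; exact: normc_ge0.
Qed.

Lemma residue_diff_unbounded (R : rcfType) (z : R[i]) d j n : (0 < d)%N ->
  1 <= normc z -> exists a b, [/\ digit_poly (residue d j) a,
    digit_poly (residue d j) b & n%:R <= normc (evalz z a - evalz z b) ^+ 2].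
Proof.
move=> d0 z1.
suff [a [b [_ _ da db ab]]] : exists a b : {poly int},
    [/\ (size a <= d * n + j)%N, (size b <= d * n + j)%N,
        digit_poly (residue d j) a, digit_poly (residue d j) b &
        n%:R <= normc (evalz z a - evalz z b) ^+ 2].
  by exists a, b.
elim: n => [|n [a [b [a_size b_size da db ab]]]].
  exists 0, 0; rewrite size_poly0 sqr_ge0.
  by split=> //; exact: digit_poly0.
set e := (d * n + j)%N in a_size b_size.
have de : residue d j e by rewrite /residue /e mulnC modnMDl.
have lt_e : (e < d * n.+1 + j)%N by rewrite mulnS -addnA -add1n leq_add2r.
set v := evalz z a - evalz z b in ab.
have parallelogram := normc_parallelogram v (z ^+ e).
have ze : 1 <= normc (z ^+ e) ^+ 2 by rewrite normcX !exprn_ege1.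
have size_old (c : {poly int}) : (size c <= e)%N -> (size c <= d * n.+1 + j)%N.
  by move=> /leq_trans; apply; exact: ltnW.
have size_new (c : {poly int}) :
    (size c <= e)%N -> (size (c + 'X^e)%R <= d * n.+1 + j)%N.
  by move=> c_size; rewrite size_polyDXn.
have [v_plus|v_plus] := lerP n.+1%:R (normc (v + z ^+ e) ^+ 2).
  exists (a + 'X^e), b; split; [exact: size_new|exact: size_old| |exact: db|].
    exact: digit_polyDXn.
  by rewrite rmorphD /= evalzXn addrAC.
exists a, (b + 'X^e); split; [exact: size_old|exact: size_new|exact: da| |].
  exact: digit_polyDXn.
rewrite rmorphD /= evalzXn opprD addrA -/v.
by move: v_plus parallelogram; rewrite -(natr1 n); lra.
Qed.

Definition residue12 : pred nat := fun i => residue 4 1 i || residue 4 2 i.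
Definition residue123 : pred nat := fun i => ~~ residue 4 0 i.

Definition digits_separated (R : numDomainType) (Q : R) (S : pred nat)
    (eta : R) : Prop :=
  forall a b, digit_poly S a -> digit_poly S b ->
    evalz Q a != evalz Q b -> eta <= `|evalz Q a - evalz Q b|.

Definition specializes (F K : comNzRingType) (S : pred nat) (Q : F) (al : K) :
    Prop :=
  forall a b, digit_poly S a -> digit_poly S b ->
    evalz Q a = evalz Q b -> evalz al a = evalz al b.

Lemma separated_window (R : realType) (K : comNzRingType) (S : pred nat)
    (Q eta L : R) (al : K) :
  0 < eta -> digits_separated Q S eta -> specializes S Q al ->
  exists n, forall x0, exists bucket : {poly int} -> 'I_n.+1, forall a b,
    digit_poly S a -> digit_poly S b ->
    x0 <= evalz Q a <= x0 + L -> x0 <= evalz Q b <= x0 + L ->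
    bucket a = bucket b -> evalz al a = evalz al b.
Proof.
move=> eta0 sep spec.
have [n bucketP] := interval_buckets L eta0; exists n => x0.
have [bucket {}bucketP] := bucketP x0.
exists (fun a => bucket (evalz Q a)) => a b da db ax bx /(bucketP _ _ ax bx).
apply: contraTeq => ne; rewrite -leNgt.
by apply: sep => //; apply: contra_neq ne; exact: spec.
Qed.

Section Conjugates.
Variables (R : realType) (Q : R).
Hypotheses (Q1 : 1 < Q) (Q42 : Q ^+ 4 <= 2).

Let Q0 : 0 < Q. Proof. exact: lt_trans Q1. Qed.

Let exprQ_le2 j : (j <= 4)%N -> Q ^+ j <= 2.
Proof. by move=> j4; apply: le_trans Q42; rewrite ler_weXn2l // ltW. Qed.

Lemma exists_residue4_approx j x : (j <= 4)%N -> 0 <= x ->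
  exists y, approx_below Q (residue 4 j) 2 x y.
Proof.
move=> j4 x0; have [//|y [dy y_x]] := exists_residue_approx j Q1 Q42 _ x0.
by exists y; split=> //; have := exprQ_le2 j4; lra.
Qed.

Lemma residue1_12 a : digit_poly (residue 4 1) a -> digit_poly residue12 a.
Proof. by apply: digit_polyS => i di; apply/orP; left. Qed.

Lemma residue2_12 a : digit_poly (residue 4 2) a -> digit_poly residue12 a.
Proof. by apply: digit_polyS => i di; apply/orP; right. Qed.

Lemma residue12D a b : digit_poly (residue 4 1) a ->
  digit_poly (residue 4 2) b -> digit_poly residue12 (a + b).
Proof. by apply: digit_polyD => i; rewrite /residue; lia. Qed.

Lemma residue123D a w : digit_poly residue12 a -> digit_poly (residue 4 3) w ->
  digit_poly residue123 (a + w).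
Proof.
move=> da dw; have disj i : residue12 i -> ~~ residue 4 3 i.
  by rewrite /residue12 /residue; lia.
apply: digit_polyS (digit_polyD disj da dw) => i.
by rewrite !unfold_in /residue12 /residue; lia.
Qed.

Variables (eta : R) (al : R[i]).
Hypotheses (eta0 : 0 < eta) (sep : digits_separated Q residue123 eta)
  (spec : specializes residue123 Q al).

(* If [w] has digits in class 3 and [w(Q)] is close to [Z - b(Q)], then [a + w]
   and [b + w] both lie in a bounded window around [Z], where a separated set
   has few points; and adding [w] does not change the difference
   [a(al) - b(al)]. *)
Lemma separated_diff_finite K : finite_set [set v | exists a b,
  [/\ digit_poly residue12 a, digit_poly residue12 b,
      `|evalz Q a - evalz Q b| <= K & v = evalz al a - evalz al b]].
Proof.
set D := [set v | _]; apply: contrapT.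
move=> /(@infinite_set_injection R[i]^o)[v v_inj vD].
have [n windowP] := separated_window (2 + 2 * K) eta0 sep spec.
pose N := (n.+1 * n.+1).+1.
have /choice[a /choice[b abP]] (i : 'I_N) : exists a b,
    [/\ digit_poly residue12 a, digit_poly residue12 b,
        `|evalz Q a - evalz Q b| <= K & v i = evalz al a - evalz al b].
  exact: vD.
pose Z := \sum_i evalz Q (b i).
have /choice[w wP] (i : 'I_N) : exists w,
    approx_below Q (residue 4 3) 2 (Z - evalz Q (b i)) w.
  apply: exists_residue4_approx => //.
  rewrite subr_ge0 /Z (bigD1 i) //= lerDl sumr_ge0 // => j _.
  by case: (abP j) => _ db _ _; exact: evalz_digit_ge0 db.
have [bucket bucketP] := windowP (Z - 2 - K).
pose phi i := (bucket (a i + w i), bucket (b i + w i)).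
have : ~ injective phi by move=> /leq_card; rewrite card_prod !card_ord ltnn.
apply=> i j [same_a same_b]; apply/ord_inj/v_inj.
have [dai dbi abi ->] := abP i; have [daj dbj abj ->] := abP j.
have [dwi wi] := wP i; have [dwj wj] := wP j.
have aw : evalz al (a i + w i) = evalz al (a j + w j).
  apply: bucketP same_a; rewrite ?rmorphD /=; try exact: residue123D.
    by move: abi wi; rewrite ler_norml; lra.
  by move: abj wj; rewrite ler_norml; lra.
have bw : evalz al (b i + w i) = evalz al (b j + w j).
  apply: bucketP same_b; rewrite ?rmorphD /=; try exact: residue123D.
    by move: abi wi; rewrite ler_norml; lra.
  by move: abj wj; rewrite ler_norml; lra.
have add_w k : evalz al (a k) - evalz al (b k) =
    evalz al (a k + w k) - evalz al (b k + w k) by rewrite !rmorphD /=; ring.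
by rewrite !add_w aw bw.
Qed.

Lemma separated_diff_bounded K : exists M, forall a b,
  digit_poly residue12 a -> digit_poly residue12 b ->
  `|evalz Q a - evalz Q b| <= K -> normc (evalz al a - evalz al b) <= M.
Proof.
have [M MP] := finite_set_normc_bounded (separated_diff_finite K).
by exists M => a b da db ab; apply: MP; exists a, b.
Qed.

Definition floor_poly (x : R) : {poly int} :=
  xget 0 [set y | approx_below Q (residue 4 1) 2 x y].

Lemma floor_polyP x : 0 <= x ->
  approx_below Q (residue 4 1) 2 x (floor_poly x).
Proof.
by move=> /(@exists_residue4_approx 1 _ isT)[y yx]; apply: xgetPex; exists y.
Qed.

Definition floor_value (x : R) : R[i] := evalz al (floor_poly x).

Lemma floor_value_quasi_additive : exists c, quasi_additive floor_value c.
Proof.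
have [M MP] := separated_diff_bounded 4; exists (M + M) => x x' x0 x0'.
have [t [t_digits t_x']] := @exists_residue4_approx 2 x' isT x0'.
have [x_digits x_floor] := floor_polyP x0.
have [x'_digits x'_floor] := floor_polyP x0'.
have [sum_digits sum_floor] := floor_polyP (addr_ge0 x0 x0').
have -> : floor_value (x + x') - floor_value x - floor_value x' =
    floor_value (x + x') - evalz al (floor_poly x + t)
    + (evalz al t - floor_value x').
  by rewrite rmorphD /= /floor_value; ring.
apply: normcD_le.
- apply: MP (residue1_12 sum_digits) (residue12D x_digits t_digits) _.
  by rewrite rmorphD /= ler_norml; lra.
- apply: MP (residue2_12 t_digits) (residue1_12 x'_digits) _.
  by rewrite ler_norml; lra.
Qed.

Lemma floor_value_scale : exists c, forall x, 0 <= x ->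
  normc (floor_value (Q * x) - al * floor_value x) <= c.
Proof.
have [M MP] := separated_diff_bounded 4; exists M => x x0.
have [x_digits x_floor] := floor_polyP x0.
have [Qx_digits Qx_floor] := floor_polyP (mulr_ge0 (ltW Q0) x0).
have shift_digits : digit_poly (residue 4 2) ('X^1 * floor_poly x).
  by apply: digit_polyXnM x_digits => i; rewrite /residue; lia.
have -> : al * floor_value x = evalz al ('X^1 * floor_poly x).
  by rewrite rmorphM /= evalzXn expr1.
apply: MP (residue1_12 Qx_digits) (residue2_12 shift_digits) _.
rewrite rmorphM /= evalzXn expr1.
have Q2 : Q <= 2 by rewrite -[Q]expr1 exprQ_le2.
case/andP: x_floor => /(ler_wpM2l (ltW Q0)) lower upper.
have {}upper : Q * x < Q * (evalz Q (floor_poly x) + 2) by rewrite ltr_pM2l.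
by rewrite mulrDr in upper; rewrite ler_norml; lra.
Qed.

Lemma floor_value_locally_bounded : locally_bounded floor_value.
Proof.
move=> x; have [n xn] := exists_lt_exprn x Q1.
exists (\sum_(i < n) normc al ^+ i) => y /andP[y0 yx].
have [y_digits y_floor] := floor_polyP y0.
have y_size : (size (floor_poly y) <= n)%N.
  by apply: (size_digit_poly Q1 y_digits); lra.
rewrite /floor_value (evalz_coef_wide _ y_size); apply: normc_sum_le => i.
case: (y_digits i) => [->|[_ ->]]; last by rewrite mul1r normcX.
by rewrite mul0r normc0 exprn_ge0 // normc_ge0.
Qed.

Lemma residue1_value_bounded : al != Q%:C -> exists b, forall a,
  digit_poly (residue 4 1) a -> normc (evalz al a) <= b.
Proof.
move=> alQ; have [c fD] := floor_value_quasi_additive.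
have [c' fM] := floor_value_scale.
have [b bP] := quasi_additive_bounded fD floor_value_locally_bounded Q0 alQ fM.
have [M MP] := separated_diff_bounded 2.
exists (M + b) => a da; have a0 := evalz_digit_ge0 Q1 da.
have [floor_digits a_floor] := floor_polyP a0.
rewrite -[evalz al a](subrK (floor_value (evalz Q a))).
apply: normcD_le (bP _ a0).
apply: MP (residue1_12 da) (residue1_12 floor_digits) _.
by rewrite ler_norml; lra.
Qed.

Lemma separated_conjugate_lt1 : al != Q%:C -> normc al < 1.
Proof.
move=> /residue1_value_bounded[b bP]; rewrite ltNge; apply/negP => al1.
have [a [c [da dc]]] :=
  residue_diff_unbounded 1 (Num.bound ((b + b) ^+ 2)) (isT : 0 < 4)%N al1.
apply/negP; rewrite -ltNge; apply: le_lt_trans (archi_boundP (sqr_ge0 _)).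
have diff_le := normcB_le (bP _ da) (bP _ dc).
by rewrite ler_sqr // nnegrE ?(le_trans _ diff_le) // normc_ge0.
Qed.

End Conjugates.

(** * Truncated power series *)

Definition eqmodXn (F : nzRingType) N (p q : {poly F}) : Prop :=
  forall i, (i < N)%N -> p`_i = q`_i.

Section TruncatedSeries.
Variable N : nat.

Lemma eqmodXn_sym (F : nzRingType) (p q : {poly F}) :
  eqmodXn N p q -> eqmodXn N q p.
Proof. by move=> pq i /pq. Qed.

Lemma eqmodXn_trans (F : nzRingType) (q p r : {poly F}) :
  eqmodXn N p q -> eqmodXn N q r -> eqmodXn N p r.
Proof. by move=> pq qr i iN; rewrite pq // qr. Qed.

Lemma eqmodXnM (F : nzRingType) (p p' q q' : {poly F}) :
  eqmodXn N p p' -> eqmodXn N q q' -> eqmodXn N (p * q) (p' * q').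
Proof.
move=> pp' qq' i iN; rewrite !coefM; apply: eq_bigr => j _.
rewrite pp' ?qq' //; first by rewrite (leq_ltn_trans (leq_subr _ _)).
by apply: leq_ltn_trans iN; rewrite -ltnS.
Qed.

Lemma eqmodXnMl (F : nzRingType) (p q q' : {poly F}) :
  eqmodXn N q q' -> eqmodXn N (p * q) (p * q').
Proof. exact: eqmodXnM. Qed.

Lemma eqmodXn_map (F G : nzRingType) (f : {rmorphism F -> G}) (p q : {poly F}) :
  eqmodXn N p q -> eqmodXn N (map_poly f p) (map_poly f q).
Proof. by move=> pq i iN; rewrite !coef_map pq. Qed.

Lemma exists_eqmodXn_inv (F : comNzRingType) (p : {poly F}) : p`_0 = 1 ->
  exists u, eqmodXn N (u * p) 1.
Proof.
move=> p0; pose e := 1 - p; exists (\sum_(j < N) e ^+ j) => i iN.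
have -> : (\sum_(j < N) e ^+ j) * p = 1 - e ^+ N.
  rewrite -[1 in RHS](expr1n _ N) subrXX opprB addrCA subrr addr0 mulrC.
  by congr (_ * _); apply: eq_bigr => j _; rewrite expr1n mul1r.
have -> : e = drop_poly 1 e * 'X.
  rewrite -[LHS](poly_take_drop 1) expr1 [X in X + _](_ : _ = 0) ?add0r //.
  apply/polyP => -[|k]; rewrite coef_take_poly coef0 //=.
  by rewrite coefB coef1 p0 subrr.
by rewrite coefB exprMn coefMXn iN subr0.
Qed.

Lemma exists_eqmodXn_div (F : comNzRingType) (p q : {poly F}) : p`_0 = 1 ->
  exists u, eqmodXn N (p * u) q.
Proof.
move=> /exists_eqmodXn_inv[v vp]; exists (q * v).
by rewrite mulrCA -[X in eqmodXn _ _ X]mulr1 [p * v]mulrC; exact: eqmodXnMl.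
Qed.

Lemma eqmodXn_mulI (F : comNzRingType) (p q q' : {poly F}) : p`_0 = 1 ->
  eqmodXn N (p * q) (p * q') -> eqmodXn N q q'.
Proof.
move=> /exists_eqmodXn_inv[v vp] pq.
have cancel_p r : eqmodXn N (v * (p * r)) r.
  by rewrite mulrA -[X in eqmodXn _ _ X]mul1r; exact: eqmodXnM.
apply: eqmodXn_trans (eqmodXn_sym (cancel_p q)) _.
by apply: eqmodXn_trans (cancel_p q'); exact: eqmodXnMl.
Qed.

End TruncatedSeries.

Definition recip_poly (F : nzRingType) (p : {poly F}) : {poly F} :=
  \poly_(i < size p) p`_((size p).-1 - i).

Lemma coef0_recip_poly (F : nzRingType) (p : {poly F}) :
  (recip_poly p)`_0 = lead_coef p.
Proof.
rewrite coef_poly subn0 lead_coefE; case: posnP => // p0.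
by rewrite nth_default // p0.
Qed.

Lemma map_recip_poly (F G : nzRingType) (f : {rmorphism F -> G})
    (p : {poly F}) :
  injective f -> map_poly f (recip_poly p) = recip_poly (map_poly f p).
Proof.
move=> f_inj; apply/polyP => i.
rewrite coef_map [in LHS]coef_poly [RHS]coef_poly.
rewrite size_map_inj_poly ?rmorph0 //; case: ifP => _; last exact: rmorph0.
by rewrite coef_map.
Qed.

Lemma recip_polyXsubCM (F : idomainType) (a : F) (p : {poly F}) :
  recip_poly (('X - a%:P) * p) = (1 - a%:P * 'X) * recip_poly p.
Proof.
have [->|p0] := eqVneq p 0.
  by rewrite mulr0 /recip_poly size_poly0 !poly_def !big_ord0 mulr0.
have [n size_p] : exists n, size p = n.+1.
  by exists (size p).-1; rewrite prednK // size_poly_gt0.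
have size_Xp : size (('X - a%:P) * p) = n.+2.
  by rewrite size_monicM ?monicXsubC // size_XsubC size_p.
apply/polyP => i.
rewrite [in RHS]mulrBl mul1r -mulrA coefB coefCM coefXM !coef_poly.
rewrite size_Xp mulrBl coefB coefXM coefCM size_p.
case: i => [|i] /=; first by rewrite !subn0 [p`_n.+1]nth_default ?size_p.
rewrite subSS !ltnS; case: (ltngtP i n) => [lt_in|//|->].
- by rewrite subn_eq0 leqNgt lt_in /= subnS.
- by rewrite mulr0 subr0.
- by rewrite subnn.
Qed.

Lemma recip_poly_prod_XsubC (F : idomainType) (rs : seq F) :
  recip_poly (\prod_(a <- rs) ('X - a%:P)) = \prod_(a <- rs) (1 - a%:P * 'X).
Proof.
elim: rs => [|a rs IH]; last by rewrite !big_cons recip_polyXsubCM IH.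
rewrite !big_nil; apply/polyP => -[|i];
  by rewrite coef_poly size_poly1 /= ?coef1.
Qed.

Lemma self_reciprocal_roots (R : rcfType) (th e : R[i]) (rs : seq R[i]) :
  let p := ('X - th%:P) * \prod_(a <- rs) ('X - a%:P) in
  all (fun a => normc a < 1) rs -> e != 0 -> p = e *: recip_poly p ->
  {in rs, forall a, a = th^-1}.
Proof.
move=> p rs1 e0 p_recip a ars.
have : root (recip_poly p) a.
  by rewrite -(rootZ _ _ e0) -p_recip /p rootM root_prod_XsubC ars orbT.
rewrite /p recip_polyXsubCM recip_poly_prod_XsubC rootM => /orP[|].
  rewrite rootE !hornerE subr_eq0 => /eqP tha.
  have th0 : th != 0 by apply: contra_eq_neq tha => ->; rewrite mul0r oner_eq0.
  by apply: (mulfI th0); rewrite -tha divff.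
rewrite rootE horner_prod prodf_seq_eq0 => /hasP[b brs].
rewrite /= !hornerE subr_eq0 => /eqP ba.
have : normc (b * a) < 1 by rewrite normcM mulr_ilt1 ?normc_ge0 ?(allP rs1).
by rewrite -ba normc1 ltxx.
Qed.

(** * Truncated Blaschke products *)

Section Blaschke.
Variable R : rcfType.
Local Notation C := R[i].

Lemma blaschke_step (a s w : C) :
  normc (- a * s + (1 - normc a ^+ 2)%:C * w) ^+ 2
    + (1 - normc a ^+ 2) * normc (conjc a * w + s) ^+ 2
  = normc s ^+ 2 + (1 - normc a ^+ 2) * normc w ^+ 2.
Proof.
by case: a s w => [a b] [c d] [x y]; rewrite !sqr_normcE; simpc => /=; ring.
Qed.

Lemma blaschke_contraction (a : C) (s : {poly C}) N : normc a < 1 ->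
  exists2 t : {poly C},
    eqmodXn N ((1 - (conjc a)%:P * 'X) * t) (('X - a%:P) * s) &
    \sum_(k < N) normc t`_k ^+ 2 <= \sum_(k < N) normc s`_k ^+ 2.
Proof.
move=> a1.
pose w := fix w k := if k is k'.+1 then conjc a * w k' + s`_k' else 0.
pose t k := - a * s`_k + (1 - normc a ^+ 2)%:C * w k.
exists (\poly_(k < N) t k).
  move=> i iN.
  rewrite !mulrBl mul1r !coefB -mulrA !coefCM !coefXM !coef_poly iN.
  case: i iN => [|i] iN /=.
    by rewrite mulr0 subr0 sub0r /t /= mulr0 addr0 mulNr.
  have defectE : (1 - normc a ^+ 2)%:C = 1 - a * conjc a.
    by rewrite rmorphB rmorphXn -sqr_normc.
  by rewrite (ltnW iN) /t /= defectE; ring.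
have energy n :
    \sum_(k < n) normc (t k) ^+ 2 + (1 - normc a ^+ 2) * normc (w n) ^+ 2
    = \sum_(k < n) normc s`_k ^+ 2.
  elim: n => [|n IH]; first by rewrite !big_ord0 normc0 expr0n mulr0 addr0.
  by rewrite !big_ord_recr /= -IH -addrA blaschke_step; ring.
rewrite -energy (eq_bigr (fun k : 'I_N => normc (t k) ^+ 2)).
  rewrite lerDl mulr_ge0 ?sqr_ge0 // subr_ge0 exprn_ile1 ?normc_ge0 //.
  exact: ltW.
by move=> k _; rewrite coef_poly ltn_ord.
Qed.

Lemma blaschke_product (rs : seq C) N : all (fun a => normc a < 1) rs ->
  exists2 t : {poly C},
    eqmodXn N (\prod_(a <- rs) (1 - (conjc a)%:P * 'X) * t)
      (\prod_(a <- rs) ('X - a%:P)) &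
    \sum_(k < N) normc t`_k ^+ 2 <= 1.
Proof.
elim: rs => [_|a rs IH /= /andP[a1 /IH[s sP sN]]].
  exists 1; first by rewrite !big_nil mulr1.
  case: N => [|N]; first by rewrite big_ord0.
  rewrite big_ord_recl big1 ?addr0 => [|i _]; rewrite coef1 ?normc1 ?expr1n //.
  by rewrite normc0 expr0n.
have [t tP tN] := blaschke_contraction s N a1.
exists t; last exact: le_trans sN.
rewrite !big_cons [_ * \prod_(b <- rs) _]mulrC -mulrA.
apply: eqmodXn_trans (eqmodXnMl _ tP) _; rewrite mulrCA.
exact: eqmodXnMl.
Qed.

End Blaschke.

(** * No Pisot number is smaller than the fourth root of 2 *)

Section SmythSeries.
Variables (R : rcfType) (th : R) (P : {poly int}) (rs : seq R[i]) (N : nat).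
Hypotheses (P_monic : P \is monic) (rs1 : all (fun a => normc a < 1) rs).
Hypothesis P_factor :
  map_poly intr P = ('X - th%:C%:P) * \prod_(a <- rs) ('X - a%:P).

Local Notation toC := (map_poly (intr : int -> R[i])).

Lemma recip_poly_prod_conj : toC (recip_poly P) =
  (1 - th%:C%:P * 'X) * \prod_(a <- rs) (1 - (conjc a)%:P * 'X).
Proof.
have -> : toC (recip_poly P) = map_poly conjc (toC (recip_poly P)).
  by rewrite -map_poly_comp; apply: eq_map_poly => k /=; rewrite rmorph_int.
rewrite map_recip_poly; last exact: intr_inj.
rewrite P_factor recip_polyXsubCM recip_poly_prod_XsubC.
have conj1X (a : R[i]) : map_poly conjc (1 - a%:P * 'X) = 1 - (conjc a)%:P * 'X.
  by rewrite rmorphB rmorph1 rmorphM /= map_polyX map_polyC.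
rewrite rmorphM rmorph_prod; congr (_ * _).
  by rewrite [LHS]conj1X conjc_real.
by apply: eq_bigr => a _; exact: conj1X.
Qed.

(* [U] is the power series P / P^* truncated at order [N]; multiplied by
   (1 - th X) / (X - th), it becomes the Blaschke product of [rs]. *)
Lemma smyth_series : exists U : {poly int},
  eqmodXn N (recip_poly P * U) P /\ exists2 G : {poly R[i]},
    eqmodXn N (('X - th%:C%:P) * G) ((1 - th%:C%:P * 'X) * toC U) &
    \sum_(k < N) normc G`_k ^+ 2 <= 1.
Proof.
have recip0 : (recip_poly P)`_0 = 1.
  by rewrite coef0_recip_poly (monicP P_monic).
have [U PU] := exists_eqmodXn_div N P recip0; exists U; split=> //.
have [G BG GN] := blaschke_product N rs1; exists G => //.
apply: (@eqmodXn_mulI _ _ (toC (recip_poly P))).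
  by rewrite coef_map recip0.
apply: (@eqmodXn_trans _ _ ((1 - th%:C%:P * 'X) * toC P)).
  rewrite recip_poly_prod_conj P_factor -!mulrA; apply: eqmodXnMl.
  by rewrite mulrCA; exact: eqmodXnMl.
rewrite mulrCA -rmorphM; apply: eqmodXnMl; apply: eqmodXn_map.
exact: eqmodXn_sym.
Qed.

Lemma smyth_real_series : exists U : {poly int},
  eqmodXn N (recip_poly P * U) P /\ exists2 g : nat -> R,
    forall k, (k < N)%N -> th * g k =
      (if k is k'.+1 then g k' + th * (U`_k')%:~R else 0) - (U`_k)%:~R &
    \sum_(k < N) g k ^+ 2 <= 1.
Proof.
have [U [PU [G GU GN]]] := smyth_series; exists U; split=> //.
exists (fun k => complex.Re G`_k) => [k kN|]; last first.
  apply: le_trans GN; apply: ler_sum => k _.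
  by rewrite sqr_normcE lerDl sqr_ge0.
have := GU k kN.
rewrite !mulrBl mul1r !coefB -mulrA !coefCM !coefXM !coef_map /=.
have intE n : n%:~R = (n%:~R)%:C :> R[i] by rewrite rmorph_int.
rewrite !intE; case: k kN => [|k] _ /=.
  by case: (G`_0) => a b; rewrite mulr0 => /(congr1 (@complex.Re R)) /=; lra.
case: (G`_k) (G`_k.+1) => a b [a' b'] /(congr1 (@complex.Re R)) /=.
by lra.
Qed.

End SmythSeries.

(* The rationals below are lower bounds for 2^(-1/2), 2^(-1/4) and
   2^(-1/4) - (1 - 2^(-1/2)). *)
Lemma inv_quartic_bound (R : realFieldType) (c : R) : 0 < c -> 1 < c ^+ 4 * 2 ->
  1 - c ^+ 2 < c /\ 1 < c ^+ 2 + (c - (1 - c ^+ 2)) ^+ 2.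
Proof.
move=> c0 c4; have c2_gt : 12 / 17 < c ^+ 2.
  rewrite ltNge; apply/negP => c2_le.
  suff : (c ^+ 2) ^+ 2 <= (12 / 17) ^+ 2 by rewrite -exprM; lra.
  by rewrite ler_sqr // nnegrE ?sqr_ge0 //; lra.
have c_gt : 21 / 25 < c.
  rewrite ltNge; apply/negP => c_le; suff : c ^+ 2 <= (21 / 25) ^+ 2 by lra.
  by rewrite ler_sqr // nnegrE; lra.
split; first lra.
suff : (6 / 11) ^+ 2 < (c - (1 - c ^+ 2)) ^+ 2 by lra.
by rewrite ltr_sqr ?nnegrE; lra.
Qed.

Section SmythArithmetic.
Variables (R : realFieldType) (th : R).
Variables (u : nat -> int) (g : nat -> R) (N : nat).
Hypotheses (th1 : 1 < th) (th4 : th ^+ 4 < 2).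
Hypotheses (N1 : (1 < N)%N) (u0 : u 0%N != 0).
Hypothesis g_rec : forall k, (k < N)%N ->
  th * g k = (if k is k'.+1 then g k' + th * (u k')%:~R else 0) - (u k)%:~R.
Hypothesis g_le1 : \sum_(k < N) g k ^+ 2 <= 1.

Let c := th^-1.
Let th0 : 0 < th. Proof. exact: lt_trans th1. Qed.
Let c0 : 0 < c. Proof. by rewrite invr_gt0. Qed.
Let c_th : c * th = 1. Proof. by rewrite mulVf // gt_eqF. Qed.
Let c1 : c < 1. Proof. by rewrite -c_th ltr_pMr. Qed.

Let gE k : (k < N)%N ->
  g k = c * ((if k is k'.+1 then g k' + th * (u k')%:~R else 0) - (u k)%:~R).
Proof. by move=> kN; rewrite -g_rec // mulrA c_th mul1r. Qed.

Let g0E : g 0%N = - (c * (u 0%N)%:~R).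
Proof. by rewrite gE ?(ltnW N1) // sub0r mulrN. Qed.

Let sqr_g_le1 k : (0 < k < N)%N -> g 0%N ^+ 2 + g k ^+ 2 <= 1.
Proof.
move=> /andP[k0 kN]; apply: le_trans g_le1.
rewrite (bigD1 (Ordinal (ltnW N1))) //= lerD2l.
rewrite (bigD1 (Ordinal kN)) /=; last by rewrite -val_eqE /= -lt0n.
by rewrite lerDl sumr_ge0 // => j _; exact: sqr_ge0.
Qed.

Lemma smyth_norm_u0 : `|(u 0%N)%:~R| = 1 :> R.
Proof.
have th2 : th < 2.
  by apply: le_lt_trans th4; rewrite -[leLHS]expr1 ler_weXn2l // ltW.
have : `|g 0%N| <= 1.
  rewrite -(@expr_le1 _ 2) // real_normK ?num_real //.
  by have := @sqr_g_le1 1 N1; have := sqr_ge0 (g 1%N); lra.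
rewrite g0E normrN normrM gtr0_norm // mulrC ler_pdivrMr // mul1r.
move=> /le_lt_trans/(_ th2); rewrite -intr_norm -[2]/(2%:~R) ltr_int => u_lt2.
by have : `|u 0%N| = 1; [move: u0 u_lt2; lia|move=> ->].
Qed.

Lemma smyth_g_closed_form k :
  (forall i, (0 < i <= k)%N -> u i = 0) -> (k.+1 < N)%N ->
  g k.+1 = (u 0%N)%:~R * (1 - c ^+ 2) * c ^+ k - c * (u k.+1)%:~R.
Proof.
elim: k => [|k IH] u_eq0 kN; rewrite gE //.
  rewrite g0E mulrBr mulrDr mulrA c_th; ring.
rewrite IH ?(ltnW kN) //.
  rewrite (u_eq0 k.+1) ?leqnn // mulr0z (exprS c k); move: (c ^+ k) => ck; ring.
by move=> i /andP[i0 ik]; rewrite u_eq0 // i0 leqW.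
Qed.

(* At the first nonzero [u k] with [0 < k], the term [c * u k] of [g k] is so
   large that [g 0 ^+ 2 + g k ^+ 2] exceeds 1. *)
Lemma smyth_u_eq0 k : (0 < k < N)%N -> u k = 0.
Proof.
have [n] := ubnP k; elim: n k => // n IH [//|k] kn /andP[_ kN].
apply/eqP; apply: contraT => uk.
have gk : g k.+1 = (u 0%N)%:~R * (1 - c ^+ 2) * c ^+ k - c * (u k.+1)%:~R.
  apply: smyth_g_closed_form => // i /andP[i0 ik].
  apply: IH; first exact: leq_ltn_trans ik kn.
  by rewrite i0 (leq_ltn_trans ik) // ltnW.
have := @sqr_g_le1 k.+1 kN; rewrite leNgt => /negP[].
have c4 : 1 < c ^+ 4 * 2.
  by rewrite exprVn mulrC ltr_pdivlMr ?mul1r ?exprn_gt0.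
have [c_lt c_bound] := inv_quartic_bound c0 c4.
apply: lt_le_trans c_bound _; rewrite g0E sqrrN exprMn.
rewrite -(real_normK (num_real (_%:~R))) smyth_norm_u0 expr1n mulr1 lerD2l.
rewrite -(real_normK (num_real (g k.+1))).
rewrite ler_sqr ?nnegrE ?subr_ge0 ?(ltW c_lt) //.
have head_le : `|(u 0%N)%:~R * (1 - c ^+ 2) * c ^+ k| <= 1 - c ^+ 2.
  have c2 : 0 <= 1 - c ^+ 2 by rewrite subr_ge0 exprn_ile1 // ltW.
  rewrite !normrM smyth_norm_u0 mul1r normrX (gtr0_norm c0) (ger0_norm c2).
  by rewrite ler_piMr // exprn_ile1 // ltW.
have tail_ge : c <= `|c * (u k.+1)%:~R|.
  rewrite normrM (gtr0_norm c0) ler_peMr ?(ltW c0) // -intr_norm ler1z.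
  by rewrite -gtz0_ge1 normr_gt0.
by have := lerB_dist (c * (u k.+1)%:~R) ((u 0%N)%:~R * (1 - c ^+ 2) * c ^+ k);
  rewrite distrC -gk; lra.
Qed.

End SmythArithmetic.

Lemma smyth_self_reciprocal (R : rcfType) (th : R) (P : {poly int})
    (rs : seq R[i]) :
  1 < th -> th ^+ 4 < 2 -> P \is monic -> P.[0] != 0 ->
  map_poly intr P = ('X - th%:C%:P) * \prod_(a <- rs) ('X - a%:P) ->
  all (fun a => normc a < 1) rs -> P = P.[0] *: recip_poly P.
Proof.
move=> th1 th4 P_monic P0 P_factor rs1.
pose N := size P; have N1 : (1 < N)%N.
  have toC_inj : injective (intr : int -> R[i]) by exact: intr_inj.
  rewrite /N -(size_map_inj_poly toC_inj) //.
  have -> : map_poly intr P = \prod_(a <- th%:C :: rs) ('X - a%:P).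
    by rewrite big_cons.
  by rewrite size_prod_XsubC.
have [U [PU [g g_rec g_le1]]] := smyth_real_series N P_monic rs1 P_factor.
have U0 : U`_0 = P.[0].
  have := PU 0%N (ltnW N1).
  rewrite coefM big_ord1 coef0_recip_poly (monicP P_monic) mul1r.
  by rewrite horner_coef0.
have U_eq0 k : (0 < k < N)%N -> U`_k = 0.
  by apply: smyth_u_eq0 th1 th4 N1 _ g_rec g_le1 k; rewrite U0.
apply/polyP => i; case: (ltnP i N) => iN; last first.
  by rewrite nth_default // coefZ coef_poly ltnNge iN mulr0.
rewrite -U0 -mul_polyC mulrC -PU //; apply: eqmodXnMl iN => -[|k] kN.
  by rewrite coefC.
by rewrite coefC /= U_eq0 // kN.
Qed.

Lemma normc_horner1_lt1 (R : rcfType) (th : R) (rs : seq R[i]) : 1 < th < 2 ->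
  {in rs, forall a, a = th%:C^-1} ->
  normc (('X - th%:C%:P) * \prod_(a <- rs) ('X - a%:P)).[1] < 1.
Proof.
move=> /andP[th1 th2] rs_inv; have th0 : 0 < th by exact: lt_trans th1.
have norm_1B y : normc (1 - y%:C : R[i]) = `|1 - y|.
  by rewrite -(rmorph1 (real_complex R)) -rmorphB normc_real.
rewrite hornerM horner_prod hornerXsubC normcM norm_1B.
rewrite ltr0_norm ?subr_lt0 // opprB.
apply: (@le_lt_trans _ _ (th - 1)); last lra.
rewrite ler_piMr ?subr_ge0 ?(ltW th1) //.
rewrite big_seq; elim/big_ind: _ => [|y z y1 z1|a /rs_inv ->].
- by rewrite normc1.
- by rewrite normcM mulr_ile1 ?normc_ge0.
have thV0 : 0 < th^-1 by rewrite invr_gt0.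
have thV1 : th^-1 < 1 by rewrite invf_lt1.
by rewrite hornerXsubC -fmorphV norm_1B ger0_norm; lra.
Qed.

Section RootOfIrreducible.
Variables (F : realFieldType) (K : fieldType) (f : {rmorphism F -> K}).
Variables (p : {poly F}) (x : K).
Hypotheses (p_irr : irreducible_poly p) (px : root (map_poly f p) x).

Lemma irreducible_root_dvdp (g : {poly F}) : root (map_poly f g) x -> p %| g.
Proof.
move=> gx; apply: contraT; rewrite -irreducible_poly_coprime // => pg.
have := coprimep_root (p := map_poly f p) (q := map_poly f g).
by rewrite coprimep_map => /(_ x pg px); rewrite (eqP gx) eqxx.
Qed.

Lemma irreducible_root_simple : ~~ root (map_poly f p^`()) x.
Proof.
apply/negP => /irreducible_root_dvdp/dvdp_leq; rewrite size_deriv.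
have p_size : (1 < size p)%N by case: p_irr.
rewrite -size_poly_gt0 size_deriv -subn1 subn_gt0 p_size => /(_ isT).
by rewrite leqNgt subn1 prednK ?leqnn // ltnW.
Qed.

Lemma irreducible_rational_root (c : F) : root p c -> x = f c.
Proof.
move=> pc; have : p %| 'X - c%:P.
  by apply: contraT; rewrite -irreducible_poly_coprime // coprimep_XsubC pc.
rewrite -(dvdp_map f) rmorphB /= map_polyX map_polyC => /root_dvdp/(_ px).
by rewrite root_XsubC => /eqP.
Qed.

End RootOfIrreducible.

Lemma map_poly_ratr_int (K : numFieldType) (P : {poly int}) :
  map_poly ratr (map_poly intr P : {poly rat}) = map_poly intr P :> {poly K}.
Proof.
by rewrite -map_poly_comp; apply: eq_map_poly => k /=; rewrite ratr_int.
Qed.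

Lemma evalz_conjugate (K : numFieldType) (x y : K) (P f : {poly int}) :
  irreducible_poly (map_poly intr P : {poly rat}) ->
  evalz x P = 0 -> evalz y P = 0 -> evalz x f = 0 -> evalz y f = 0.
Proof.
move=> P_irr Px Py fx.
have ratr_root (z : K) (g : {poly int}) :
    root (map_poly ratr (map_poly intr g : {poly rat})) z = (evalz z g == 0).
  by rewrite map_poly_ratr_int.
have : map_poly intr P %| (map_poly intr f : {poly rat}).
  apply: (irreducible_root_dvdp (x := x) (f := ratr) P_irr).
    by rewrite ratr_root Px.
  by rewrite ratr_root fx.
rewrite -(dvdp_map (ratr : rat -> K)) => /root_dvdp root_f.
by have := root_f y; rewrite !ratr_root Py eqxx => /(_ isT)/eqP.
Qed.

Lemma monic_dvdp_rat_int (p : {poly rat}) (D : {poly int}) :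
  p \is monic -> lead_coef D \is a GRing.unit -> p %| map_poly intr D ->
  exists2 P : {poly int}, P \is monic & p = map_poly intr P.
Proof.
move=> /monicP p_monic D_unit /dvdpP_rat_int[p1 [a a0 pE] [r Dr]].
have l_unit : lead_coef p1 \is a GRing.unit.
  by move: D_unit; rewrite Dr lead_coefM unitrM => /andP[].
set l := lead_coef p1 in l_unit.
have ll : l * l = 1 by case/orP: l_unit => /eqP ->.
exists (l *: p1); first by rewrite monicE lead_coefZ ll.
have al : a * l%:~R = 1.
  rewrite -[RHS]p_monic pE lead_coefZ lead_coef_map_inj //; exact: intr_inj.
rewrite map_polyZ pE; congr (_ *: _); rewrite -[RHS]mul1r -al -mulrA.
by rewrite -[X in _ * X]rmorphM ll mulr1.
Qed.

Lemma exists_int_minimal_polynomial (L : numClosedFieldType) (z : L)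
    (D : {poly int}) : lead_coef D \is a GRing.unit -> evalz z D = 0 ->
  exists P : {poly int}, [/\ P \is monic,
    irreducible_poly (map_poly intr P : {poly rat}) & evalz z P = 0].
Proof.
move=> D_unit Dz.
have z_integral : integralOver (ratr : rat -> L) z.
  exists (map_poly intr (lead_coef D *: D)); last first.
    by rewrite map_poly_ratr_int map_polyZ /= rootE hornerZ [_.[z]]Dz mulr0.
  apply: monic_map; rewrite monicE lead_coefZ.
  by case/orP: D_unit => /eqP ->.
have ratr_decidable :
    algebraics_fundamentals.decidable_embedding (ratr : rat -> L).
  by move=> y; exact: pselect.
have [p [p_monic pz p_irr]] :=
  algebraics_fundamentals.minPoly_decidable_closure ratr_decidable z_integral.
have pD : p %| map_poly intr D.
  apply: (irreducible_root_dvdp p_irr pz).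
  by rewrite map_poly_ratr_int; exact/eqP.
have [P P_monic pE] := monic_dvdp_rat_int p_monic D_unit pD.
exists P; split=> //; first by rewrite -pE.
by apply/eqP; rewrite /evalz -map_poly_ratr_int -pE.
Qed.

Lemma prod_XsubC_deriv_root (F : idomainType) (x : F) (rs : seq F) : x \in rs ->
  root (('X - x%:P) * \prod_(a <- rs) ('X - a%:P))^`() x.
Proof.
move=> xrs; rewrite (big_rem x) //= derivM derivXsubC mul1r rootE !hornerE.
by rewrite subrr !mul0r addr0.
Qed.

Lemma monic_int_factorization (L : numClosedFieldType) (P : {poly int})
    (z : L) :
  P \is monic -> evalz z P = 0 -> exists2 rs : seq L,
    map_poly intr P = ('X - z%:P) * \prod_(a <- rs) ('X - a%:P) &
    {in rs, forall a, evalz a P = 0}.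
Proof.
move=> P_monic Pz; have PC_monic : (map_poly intr P : {poly L}) \is monic.
  exact: monic_map.
have [rs PE] := closed_field_poly_normal (map_poly intr P : {poly L}).
rewrite (monicP PC_monic) scale1r in PE.
have mem_rs a : (a \in rs) = (evalz a P == 0) by rewrite -root_prod_XsubC -PE.
have zrs : z \in rs by rewrite mem_rs Pz.
exists (rem z rs) => [|a /mem_rem]; last by rewrite mem_rs => /eqP.
by rewrite PE (big_rem z).
Qed.

Lemma pisot_factorization (R : realType) (x : R) : pisot x ->
  exists (P : {poly int}) (rs : seq R[i]),
  [/\ P \is monic, P.[0] != 0, P.[1] != 0,
    map_poly intr P = ('X - x%:C%:P) * \prod_(a <- rs) ('X - a%:P) &
    all (fun a => normc a < 1) rs].
Proof.
move=> [x1 [P [P_monic P_irr Px conj_lt1]]].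
have PxC : evalz (x%:C : R[i]) P = 0.
  by rewrite -rmorph_evalz [evalz x P](eqP Px).
have [rs PE rs_root] := monic_int_factorization P_monic PxC.
have no_int_root (k : int) : x != k%:~R -> P.[k] != 0.
  apply: contra_neq => Pk.
  have ratr_root : root (map_poly ratr (map_poly intr P : {poly rat})) x.
    by rewrite map_poly_ratr_int.
  rewrite -(ratr_int R k); apply: (irreducible_rational_root P_irr ratr_root).
  by rewrite rootE horner_map Pk.
have x_simple : x%:C \notin rs.
  have := irreducible_root_simple (f := ratr : rat -> R[i]) (x := x%:C) P_irr.
  rewrite -deriv_map !map_poly_ratr_int => simple.
  have /simple : root (map_poly intr P) (x%:C : R[i]) by apply/eqP.
  by apply: contra => /prod_XsubC_deriv_root; rewrite -PE.
exists P, rs; split=> //.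
- by apply: no_int_root; rewrite gt_eqF // (lt_trans ltr01).
- by apply: no_int_root; rewrite gt_eqF.
apply/allP => a ars; rewrite -ltcR; apply: conj_lt1.
  by rewrite rootE; apply/eqP; exact: rs_root.
by apply: contraNneq x_simple => <-.
Qed.

Lemma pisot_expr4_ge2 (R : realType) (x : R) : pisot x -> 2 <= x ^+ 4.
Proof.
move=> x_pisot; have x1 : 1 < x by case: x_pisot.
have [P [rs [P_monic P0 P1 P_factor rs1]]] := pisot_factorization x_pisot.
rewrite leNgt; apply/negP => x4.
have P_recip := smyth_self_reciprocal x1 x4 P_monic P0 P_factor rs1.
have rs_inv : {in rs, forall a, a = x%:C^-1}.
  apply: (@self_reciprocal_roots R x%:C (P.[0])%:~R) => //.
    by rewrite intr_eq0.
  rewrite -P_factor -map_recip_poly -?map_polyZ -?P_recip //.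
  exact: intr_inj.
have := normc_int_ge1 R P1; rewrite leNgt => /negP[].
have -> : (P.[1])%:~R = (map_poly intr P).[1] :> R[i].
  by rewrite -[1 in RHS]/(1%:~R) horner_map.
rewrite P_factor; apply: normc_horner1_lt1 rs_inv; rewrite x1.
by apply: le_lt_trans x4; rewrite -[leLHS]expr1 ler_weXn2l // ltW.
Qed.

Section SmallDifferences.
Variables (R : realType) (Q : R).
Hypotheses (Q1 : 1 < Q) (Q42 : Q ^+ 4 < 2).

Lemma digits_separated_pisot eta :
  0 < eta -> digits_separated Q residue123 eta -> pisot Q.
Proof.
move=> eta0 sep; split=> //.
have conj_lt1 al := separated_conjugate_lt1 (al := al) Q1 (ltW Q42) eta0 sep.
have not_spec1 : ~ specializes residue123 Q (1 : R[i]).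
  move=> /conj_lt1; rewrite normc1 ltxx => neq_false.
  suff /neq_false : 1 != Q%:C by [].
  by rewrite -(rmorph1 (real_complex R)) (inj_eq (@complexI R)) lt_eqF.
have [a [b [da db ab ab1]]] : exists a b,
    [/\ digit_poly residue123 a, digit_poly residue123 b,
        evalz Q a = evalz Q b & evalz (1 : R[i]) a != evalz 1 b].
  apply: contrapT => no_relation; apply: not_spec1 => a b da db ab.
  by apply/eqP; apply: contraT => ne; case: no_relation; exists a, b.
have ab_unit : lead_coef (a - b) \is a GRing.unit.
  have : a - b != 0 by apply: contraNneq ab1 => /subr0_eq ->.
  rewrite -lead_coef_eq0 lead_coefE coefB; move: (size _).-1 => n.
  by case: (da n) => [->|[_ ->]]; case: (db n) => [->|[_ ->]].
have abQ : evalz (Q%:C : R[i]) (a - b) = 0.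
  by rewrite -rmorph_evalz rmorphB /= ab subrr rmorph0.
have [P [P_monic P_irr PQ]] := exists_int_minimal_polynomial ab_unit abQ.
exists P; split=> // [|z Pz zQ].
  by move/eqP: PQ; rewrite -rmorph_evalz fmorph_eq0.
rewrite normr_normc ltcR; apply: conj_lt1 zQ => u v du dv uv.
apply: subr0_eq; rewrite -rmorphB.
apply: (evalz_conjugate P_irr PQ); first exact/eqP.
by rewrite -rmorph_evalz rmorphB /= uv subrr rmorph0.
Qed.

Lemma digits_not_separated eta : 0 < eta -> ~ digits_separated Q residue123 eta.
Proof.
move=> eta0 /(digits_separated_pisot eta0)/pisot_expr4_ge2.
by rewrite leNgt Q42.
Qed.

End SmallDifferences.

(** * Digit sums *)

Definition digit_sum (F : fieldType) (q : F) (n : nat) (c : nat -> bool) : F :=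
  \sum_(k < n) (c k)%:R * q ^- k.+1.

Section DigitSum.
Variables (F : fieldType) (q : F).
Implicit Types (c : nat -> bool).

Lemma digit_sum0 c : digit_sum q 0 c = 0.
Proof. exact: big_ord0. Qed.

Lemma eq_digit_sum n c c' : (forall k, (k < n)%N -> c k = c' k) ->
  digit_sum q n c = digit_sum q n c'.
Proof. by move=> cc'; apply: eq_bigr => k _; rewrite cc'. Qed.

Lemma digit_sumD m n c : digit_sum q (m + n) c =
  digit_sum q m c + q ^- m * digit_sum q n (fun k => c (m + k)%N).
Proof.
rewrite /digit_sum big_split_ord /=; congr (_ + _); rewrite mulr_sumr.
by apply: eq_bigr => k _; rewrite -addnS exprD invfM mulrCA.
Qed.

Lemma digit_sum_digit_poly S (y : {poly int}) n : q != 0 -> digit_poly S y ->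
  (size y <= n)%N ->
  digit_sum q n (fun k => y`_(n - k.+1) == 1) = q ^- n * evalz q y.
Proof.
move=> q0 yd yn; rewrite (evalz_coef_wide q yn) mulr_sumr.
rewrite /digit_sum (reindex_inj rev_ord_inj) /=.
apply: eq_bigr => i _; have i_n := ltn_ord i.
rewrite subnSK // subKn ?(ltnW i_n) // mulrCA.
have -> : q ^- n * q ^+ i = q ^- (n - i).
  by rewrite expfB_cond ?(negbTE q0) ?invf_div 1?mulrC // ltnW.
by case: (yd i) => [->|[_ ->]]; rewrite ?eqxx.
Qed.

End DigitSum.

Lemma digit_sum_le (R : realFieldType) (Q : R) n c : 1 < Q ->
  0 <= digit_sum Q n c <= (Q - 1)^-1.
Proof.
move=> Q1; have Q0 : 0 < Q by exact: lt_trans Q1.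
have Qm : 0 < Q - 1 by rewrite subr_gt0.
have QV k : 0 < Q ^- k by rewrite invr_gt0 exprn_gt0.
rewrite sumr_ge0 => [|k _]; last by rewrite mulr_ge0 // ltW.
suff : digit_sum Q n c * (Q - 1) <= 1 - Q ^- n.
  rewrite -[(Q - 1)^-1]mul1r ler_pdivlMr // => /le_trans; apply.
  by rewrite gerBl ltW.
elim: n => [|n IH]; first by rewrite digit_sum0 mul0r expr0 invr1 subrr.
rewrite /digit_sum big_ord_recr /= mulrDl -lerBrDr; apply: le_trans IH _.
have c1 : (c n)%:R <= 1 :> R by case: (c n).
have QS : Q ^- n = Q * Q ^- n.+1 by rewrite exprS invfM mulVKf // gt_eqF.
have := ler_wpM2r (mulr_ge0 (ltW (QV n.+1)) (ltW Qm)) c1.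
by rewrite mul1r mulrA QS; lra.
Qed.

(** * Small gaps between the values of digit polynomials *)

Section Gaps.
Variables (R : realType) (Q : R).
Hypotheses (Q1 : 1 < Q) (Q42 : Q ^+ 4 < 2).

Let Q0 : 0 < Q. Proof. exact: lt_trans Q1. Qed.

Lemma small_digit_difference eta : 0 < eta -> exists a b,
  [/\ digit_poly residue123 a, digit_poly residue123 b &
      0 < evalz Q a - evalz Q b < eta].
Proof.
move=> eta0; apply: contrapT => no_small.
apply: (digits_not_separated Q1 Q42 eta0) => a b da db.
wlog lt_ba : a b da db / evalz Q b < evalz Q a => [wlog_lt|_].
  move=> ne; have := ne; rewrite neq_lt => /orP[lt|lt]; last exact: wlog_lt.
  by rewrite distrC; apply: wlog_lt; rewrite 1?eq_sym.
rewrite gtr0_norm ?subr_gt0 // leNgt; apply/negP => small.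
by apply: no_small; exists a, b; split=> //; rewrite subr_gt0 lt_ba.
Qed.

(* A very small difference grows by a factor [Q ^+ 4 < 2] at each multiplication
   by ['X^4], so it cannot jump over the interval [delta / 2, delta[. *)
Lemma digit_difference_step n delta : 0 < delta -> exists a b,
  [/\ digit_poly (fun i => residue123 i && (n <= i)%N) a,
      digit_poly (fun i => residue123 i && (n <= i)%N) b &
      delta / 2 <= evalz Q a - evalz Q b < delta].
Proof.
move=> delta0; have QX k : 0 < Q ^+ (4 * k) by rewrite exprn_gt0.
have [|a [b [da db]]] := @small_digit_difference (delta / 2 / Q ^+ (4 * n)).
  by rewrite !divr_gt0.
set eta := evalz Q a - evalz Q b => /andP[eta0].
rewrite ltr_pdivlMr // => eta_n.
pose large k := delta / 2 <= eta * Q ^+ (4 * k).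
have ex_large : exists k, large k.
  have [k kP] := exists_lt_exprn (delta / 2 / eta) Q1; exists k.
  rewrite /large -ler_pdivrMl // mulrC (le_trans (ltW kP)) //.
  by rewrite ler_weXn2l ?(ltW Q1) // leq_pmull.
have [k k_large k_min] := ex_minnP ex_large.
have nk : (n < k)%N.
  rewrite ltnNge; apply/negP => kn; move: eta_n; rewrite ltNge => /negP[].
  apply: le_trans k_large _; rewrite ler_pM2l // ler_weXn2l ?(ltW Q1) //.
  by rewrite leq_mul2l kn orbT.
have shift u : digit_poly residue123 u ->
    digit_poly (fun i => residue123 i && (n <= i)%N) ('X^(4 * k) * u).
  by apply: digit_polyXnM => i; rewrite /residue123 /residue; lia.
exists ('X^(4 * k) * a), ('X^(4 * k) * b); split; [exact: shift..|].
rewrite -rmorphB -mulrBr rmorphM rmorphB /= evalzXn -/eta [_ * eta]mulrC.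
apply/andP; split; first exact: k_large.
case: k nk k_min {shift k_large} => [//|k] _ k_min.
have : ~~ large k by apply/negP => /k_min; rewrite ltnn.
rewrite /large -ltNge mulnS exprD mulrCA => small_k.
have := mulr_gt0 eta0 (QX k); move: small_k; set x := eta * _ => small_k x0.
have : Q ^+ 4 * x < 2 * x by rewrite ltr_pM2r.
lra.
Qed.

Lemma digit_difference_chain N delta : 0 < delta ->
  exists g : nat -> {poly int}, (forall i, digit_poly residue123 (g i)) /\
    forall i, (i < N)%N ->
      delta / 2 <= evalz Q (g i.+1) - evalz Q (g i) < delta.
Proof.
move=> delta0; elim: N => [|N [g [gd gs]]].
  by exists (fun=> 0); split=> // i; exact: digit_poly0.
pose n := \max_(i < N.+1) size (g i).
have [a [b [da db ab]]] := digit_difference_step n delta0.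
have g_add i u : (i <= N)%N ->
    digit_poly (fun j => residue123 j && (n <= j)%N) u ->
    digit_poly residue123 (g i + u).
  rewrite -ltnS => iN du; have gn : (size (g i) <= n)%N.
    exact: (@leq_bigmax _ (fun j : 'I_N.+1 => size (g j)) (Ordinal iN)).
  have disj j : residue123 j && (j < n)%N -> ~~ (residue123 j && (n <= j)%N).
    by move=> /andP[-> jn]; rewrite -ltnNge.
  apply: digit_polyS (digit_polyD disj (digit_poly_below gn (gd i)) du) => j.
  by move=> /orP[] /andP[].
exists (fun i => if (i <= N)%N then g i + b else g N + a); split=> [i|i iN].
  by case: ifP => iN; exact: g_add.
rewrite (iN : (i <= N)%N); case: ltnP => [iN'|Ni]; rewrite !rmorphD opprD /=.
  by rewrite addrACA subrr addr0 gs.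
have -> : i = N by apply/eqP; rewrite eqn_leq Ni -ltnS iN.
by rewrite addrACA subrr add0r.
Qed.

Lemma exists_fine_approx delta : 0 < delta -> exists A, forall t, A <= t ->
  exists y, approx_below Q xpredT delta t y.
Proof.
move=> delta0; pose N := Num.bound (2 / delta).
have N1 : 1 < N%:R * (delta / 2).
  have : 2 / delta < N%:R by apply: archi_boundP; rewrite divr_ge0 // ltW.
  by rewrite ltr_pdivrMr //; lra.
have [g [gd gs]] := digit_difference_chain N delta0.
pose G i := evalz Q (g i).
have G_ge i : (i <= N)%N -> G 0%N + i%:R * (delta / 2) <= G i.
  elim: i => [|i IH] iN; first by rewrite mul0r addr0.
  have := IH (ltnW iN); have := gs i iN.
  by rewrite -(natr1 i) mulrDl /G; lra.
exists (G 0%N) => t tG.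
have [//||y [yd]] := @exists_residue_approx R Q 4 0 (t - G 0%N) Q1 (ltW Q42).
  by rewrite subr_ge0.
rewrite expr0 => y_t.
have ex_below : exists i, (i <= N)%N && (G i <= t - evalz Q y).
  by exists 0%N => /=; lra.
have [//|i /andP[iN Gi] i_max] := ex_maxnP (m := N) ex_below _.
  by move=> j /andP[].
have {}iN : (i < N)%N.
  rewrite ltn_neqAle iN andbT; apply/eqP => i_eq; rewrite i_eq in Gi.
  by have := G_ge N (leqnn N); lra.
exists (y + g i); split.
  apply: (@digit_polyS (fun j => residue 4 0 j || residue123 j)) => //.
  by apply: digit_polyD yd (gd i) => j; rewrite negbK.
have : ~~ (G i.+1 <= t - evalz Q y).
  by apply/negP => Gi1; have := i_max i.+1; rewrite iN Gi1 ltnn => /(_ isT).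
by rewrite -ltNge rmorphD /=; have := gs i iN; rewrite -!/(G _); lra.
Qed.

Lemma steer_block (t : R) (e : nat -> bool) (B : nat) : 0 < t < 1 ->
  exists M0, forall M, (M0 <= M)%N -> exists (d : nat -> bool) (t' : R),
    [/\ 0 < t' < 1, forall l, (l < B)%N -> d (M + l)%N = e l &
        t = digit_sum Q (M + B) d + Q ^- (M + B) * t'].
Proof.
move=> /andP[t0 t1].
have QX n : 0 < Q ^+ n by rewrite exprn_gt0.
have Qu n : Q ^+ n != 0 by rewrite gt_eqF.
pose s := digit_sum Q B e; pose h := Q ^- B / 3.
have h0 : 0 < h by rewrite divr_gt0 // invr_gt0.
have /andP[s0 _] : 0 <= s <= _ := digit_sum_le B e Q1.
have [A approx] := exists_fine_approx h0.
have [M0 M0P] := exists_lt_exprn ((A + s + h) / t) Q1.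
exists M0 => M M0M; have [|y [yd yt]] := approx (Q ^+ M * t - s - h).
  have : (A + s + h) / t < Q ^+ M.
    by apply: lt_le_trans M0P _; rewrite ler_weXn2l // ltW.
  by rewrite ltr_pdivrMr //; lra.
have y_size : (size y <= M)%N.
  apply: (size_digit_poly Q1 yd).
  have : Q ^+ M * t < Q ^+ M by rewrite gtr_pMr.
  lra.
pose y_digit l := y`_(M - l.+1) == 1.
exists (fun l => if (l < M)%N then y_digit l else e (l - M)%N).
exists (Q ^+ B * (Q ^+ M * t - evalz Q y - s)); split.
- have Qh : Q ^+ B * h = 1 / 3 by rewrite mulrA divff.
  set t' := Q ^+ B * _.
  have lower : Q ^+ B * h <= t' by rewrite ler_pM2l //; lra.
  have upper : t' < Q ^+ B * (2 * h) by rewrite ltr_pM2l //; lra.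
  by move: lower upper; rewrite [_ * (2 * h)]mulrCA Qh; lra.
- by move=> l lB; rewrite ltnNge leq_addr /= addKn.
rewrite digit_sumD (@eq_digit_sum _ Q M _ y_digit) => [|l -> //].
rewrite (@eq_digit_sum _ Q B _ e) => [|l _]; last first.
  by rewrite ltnNge leq_addr /= addKn.
rewrite (digit_sum_digit_poly _ yd y_size) ?gt_eqF // -/s exprD.
by field; rewrite !Qu.
Qed.

End Gaps.

(** * Expansions in a complex base *)

Lemma expansionP (R : realType) (q : R[i]) c z : expansion q c z <->
  forall e : R, 0 < e -> exists N, forall n, (N <= n)%N ->
    normc (z - digit_sum q n c) < e.
Proof.
rewrite /expansion /digit_sum; split.
  move=> /cvgrPdist_lt cv e e0.
  have [|N _ NP] := cv e%:C; first by rewrite ltcR.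
  by exists N => n /NP; rewrite /= /series /= big_mkord normr_normc ltcR.
move=> cv; apply/cvgrPdist_lt => _ /gt0_complex[e -> /cv[N NP]].
by exists N => // n /NP; rewrite /= /series /= big_mkord normr_normc ltcR.
Qed.

Lemma expansion_unique (R : realType) (q : R[i]) c z z' :
  expansion q c z -> expansion q c z' -> z = z'.
Proof. exact: (@cvg_unique _ (@norm_hausdorff _ R[i]^o)). Qed.

Section BoundedRemainders.
Variables (R : realType) (q : R[i]).
Hypothesis q1 : 1 < normc q.

Lemma normc_digit_sum_le n c : normc (digit_sum q n c) <= (normc q - 1)^-1.
Proof.
apply: (@le_trans _ _ (digit_sum (normc q) n c)); last first.
  by case/andP: (digit_sum_le n c q1).
apply: normc_sum_le => k; rewrite normcM normcV normcX.
by case: (c k); rewrite ?normc1 ?normc0.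
Qed.

Lemma expansion_of_bounded_remainders c z C :
  (forall n, exists r w, [/\ (n <= r)%N, normc w <= C &
    z = digit_sum q r c + q ^- r * w]) -> expansion q c z.
Proof.
move=> remainders; apply/expansionP => e e0.
have q0 : 0 < normc q by exact: lt_trans q1.
have [N NP] := exists_lt_exprn (((normc q - 1)^-1 + C) / e) q1.
exists N => n Nn; have [r [w [nr wC ->]]] := remainders n.
rewrite -(subnKC nr) digit_sumD exprD invfM.
set d := (r - n)%N; set x := digit_sum q n c; set s := digit_sum q d _.
have -> : x + q ^- n * s + q ^- n * q ^- d * w - x = q ^- n * (s + q ^- d * w).
  by ring.
have tail_le : normc (s + q ^- d * w) <= (normc q - 1)^-1 + C.
  apply: normcD_le; first exact: normc_digit_sum_le.
  rewrite normcM normcV normcX; apply: le_trans wC.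
  by rewrite ler_piMl ?normc_ge0 // invf_le1 ?exprn_gt0 // exprn_ege1 // ltW.
rewrite normcM normcV normcX mulrC ltr_pdivrMr ?exprn_gt0 //.
apply: le_lt_trans tail_le _; rewrite mulrC -ltr_pdivrMr //.
by apply: lt_le_trans NP _; rewrite ler_weXn2l // ltW.
Qed.

End BoundedRemainders.

(** * Universal sequences *)

Section Concatenation.
Variable W : nat -> seq bool.

Definition concat_prefix (n : nat) : seq bool := flatten (mkseq W n).

Definition concat (k : nat) : bool := nth false (concat_prefix k.+1) k.

Lemma concat_prefixS n : concat_prefix n.+1 = concat_prefix n ++ W n.
Proof. by rewrite /concat_prefix mkseqS flatten_rcons. Qed.

Lemma concat_prefixD n d :
  exists s, concat_prefix (n + d) = concat_prefix n ++ s.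
Proof.
elim: d => [|d [s IH]]; first by exists [::]; rewrite addn0 cats0.
by exists (s ++ W (n + d)%N); rewrite addnS concat_prefixS IH catA.
Qed.

Lemma nth_concat_prefix i n k : (i <= n)%N -> (k < size (concat_prefix i))%N ->
  nth false (concat_prefix n) k = nth false (concat_prefix i) k.
Proof.
move=> i_n ki; have [s] := concat_prefixD i (n - i).
by rewrite subnKC // => ->; rewrite nth_cat ki.
Qed.

Hypothesis W_nonempty : forall n, (0 < size (W n))%N.

Lemma leq_size_concat_prefix n : (n <= size (concat_prefix n))%N.
Proof.
elim: n => // n IH; rewrite concat_prefixS size_cat -addn1.
exact: leq_add IH (W_nonempty n).
Qed.

Lemma concatE n k : (k < size (concat_prefix n))%N ->
  concat k = nth false (concat_prefix n) k.
Proof.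
move=> kn; case: (leqP n k.+1) => nk; first exact: nth_concat_prefix.
by rewrite (nth_concat_prefix (ltnW nk)) // leq_size_concat_prefix.
Qed.

Lemma concat_universal : (forall b : seq bool, exists n, infix b (W n)) ->
  universal concat.
Proof.
move=> all_words b; have [n /infixP[s1 [s2 WE]]] := all_words b.
exists (size (concat_prefix n) + size s1)%N => i ib.
rewrite (@concatE n.+1) concat_prefixS WE.
  rewrite -addnA nth_cat ltnNge leq_addr addKn.
  by rewrite nth_cat ltnNge leq_addr addKn nth_cat ib.
by rewrite !size_cat -addnA !ltn_add2l ltn_addr.
Qed.

End Concatenation.

Definition word_value (F : fieldType) (q : F) (w : seq bool) : F :=
  digit_sum q (size w) (nth false w).

Lemma word_value_cat (F : fieldType) (q : F) (s w : seq bool) :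
  word_value q (s ++ w) = word_value q s + q ^- size s * word_value q w.
Proof.
rewrite /word_value size_cat digit_sumD; congr (_ + _ * _).
  by apply: eq_digit_sum => k ks; rewrite nth_cat ks.
by apply: eq_digit_sum => k _; rewrite nth_cat ltnNge leq_addr addKn.
Qed.

Definition steerable (F : fieldType) (q : F) (A : set F) : Prop :=
  forall z b, A z -> exists w z', [/\ A z', (0 < size w)%N, infix b w &
    z = word_value q w + q ^- size w * z'].

Lemma steerable_universal_expansion (R : realType) (q : R[i])
    (A : set R[i]) (C : R) :
  1 < normc q -> (forall z, A z -> normc z <= C) -> steerable q A ->
  forall z, A z -> exists c, expansion q c z /\ universal c.
Proof.
move=> q1 AC steer z Az; pose block n : seq bool := odflt [::] (unpickle n).
have blockK b : block (pickle b) = b by rewrite /block pickleK.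
have /choice[f fP] (x : {z | A z} * nat) : exists y : seq bool * {z | A z},
    [/\ (0 < size y.1)%N, infix (block x.2) y.1 &
        sval x.1 = word_value q y.1 + q ^- size y.1 * sval y.2].
  case: x => -[x Ax] n; have [w [x' [Ax' w0 bw xE]]] := steer x (block n) Ax.
  by exists (w, exist _ x' Ax').
pose state := fix state n :=
  if n is k.+1 then (f (state k, k)).2 else exist _ z Az.
pose W n := (f (state n, n)).1.
have W_nonempty n : (0 < size (W n))%N by case: (fP (state n, n)).
have zE n : z = word_value q (concat_prefix W n)
    + q ^- size (concat_prefix W n) * sval (state n).
  elim: n => [|n IH].
    by rewrite /word_value digit_sum0 add0r expr0 invr1 mul1r.
  have step : sval (state n) =
      word_value q (W n) + q ^- size (W n) * sval (state n.+1).
    by case: (fP (state n, n)).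
  rewrite [LHS]IH concat_prefixS word_value_cat size_cat step exprD invfM.
  by ring.
exists (concat W); split.
  apply: (expansion_of_bounded_remainders q1 (C := C)) => n.
  exists (size (concat_prefix W n)), (sval (state n)); split.
  - exact: leq_size_concat_prefix.
  - by apply: AC; exact: svalP.
  by rewrite [LHS](zE n); congr (_ + _); apply: eq_digit_sum => k /concatE ->.
apply: concat_universal => // b; exists (pickle b).
rewrite -{1}[b]blockK.
by case: (fP (state (pickle b), pickle b)).
Qed.

(** * Grouping the digits by their position modulo m *)

Section DigitValue.
Variables (R : realType) (Q : R).
Hypothesis Q1 : 1 < Q.

Definition digit_value (c : nat -> bool) : R := limn (fun n => digit_sum Q n c).

Lemma is_cvg_digit_sum c : cvgn (fun n => digit_sum Q n c).
Proof.
have Q0 : 0 < Q by exact: lt_trans Q1.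
apply: nondecreasing_is_cvgn; last first.
  by exists (Q - 1)^-1 => _ [n _ <-]; case/andP: (digit_sum_le n c Q1).
apply/nondecreasing_seqP => n.
rewrite -[n.+1]addn1 digit_sumD lerDl mulr_ge0 //.
  by rewrite invr_ge0 exprn_ge0 // ltW.
by case/andP: (digit_sum_le 1 (fun k => c (n + k)%N) Q1).
Qed.

Lemma digit_value_itv c : 0 <= digit_value c <= (Q - 1)^-1.
Proof.
apply/andP; split.
  apply: limr_ge; first exact: is_cvg_digit_sum.
  by near=> n; case/andP: (digit_sum_le n c Q1).
apply: limr_le; first exact: is_cvg_digit_sum.
by near=> n; case/andP: (digit_sum_le n c Q1).
Unshelve. all: by end_near. Qed.

Lemma digit_value_split n c :
  digit_value c = digit_sum Q n c + Q ^- n * digit_value (fun k => c (n + k)%N).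
Proof.
apply/cvg_lim => //; rewrite -(cvg_shiftn n).
under eq_fun do rewrite addnC digit_sumD.
apply: cvgD; first exact: cvg_cst.
by apply: cvgMl_tmp; exact: is_cvg_digit_sum.
Qed.

End DigitValue.

Section Grouping.
Variables (R : realType) (m : nat) (q : R[i]) (Q : R).
Hypotheses (m0 : (0 < m)%N) (Q1 : 1 < Q) (qm : q ^+ m = Q%:C).

Let Q0 : 0 < Q. Proof. exact: lt_trans Q1. Qed.

Let q0 : q != 0.
Proof.
apply: contra_eq_neq qm => ->; rewrite expr0n (gtn_eqF m0) /=.
by rewrite eq_sym fmorph_eq0 gt_eqF.
Qed.

Lemma normc_base_gt1 : 1 < normc q.
Proof.
rewrite ltNge; apply/negP => q1; move: Q1; rewrite ltNge => /negP[].
by rewrite -[Q]gtr0_norm // -normc_real -qm normcX exprn_ile1 // normc_ge0.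
Qed.

Definition of_coords (t : 'I_m -> R) : R[i] := \sum_(j < m) (t j)%:C * q ^+ j.

Lemma of_coordsD t t' :
  of_coords t + of_coords t' = of_coords (fun j => t j + t' j).
Proof.
by rewrite /of_coords -big_split; apply: eq_bigr => j _; rewrite rmorphD mulrDl.
Qed.

Lemma of_coordsZ a t : a%:C * of_coords t = of_coords (fun j => a * t j).
Proof.
by rewrite /of_coords mulr_sumr; apply: eq_bigr => j _; rewrite rmorphM mulrA.
Qed.

Lemma normc_of_coords_le t (b : R) : (forall j, `|t j| <= b) ->
  normc (of_coords t) <= b * \sum_(j < m) normc q ^+ j.
Proof.
move=> tb; rewrite mulr_sumr; apply: normc_sum_le => j.
by rewrite normcM normc_real normcX ler_wpM2r // exprn_ge0 // normc_ge0.
Qed.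

(* The digit of weight [q ^- k.+1] contributes to the coefficient of [q ^+ j]
   with [k.+1 + j] divisible by [m]. *)
Definition digit_coord (k : nat) : 'I_m := rev_ord (Ordinal (ltn_pmod k m0)).

Definition interleave (D : 'I_m -> nat -> bool) (k : nat) : bool :=
  D (digit_coord k) (k %/ m)%N.

Definition deinterleave (c : nat -> bool) (j : 'I_m) (l : nat) : bool :=
  c (m * l + (m - j.+1))%N.

Lemma digit_coord_mulD l k : digit_coord (m * l + k) = digit_coord k.
Proof. by apply: val_inj; rewrite /= mulnC modnMDl. Qed.

Lemma interleave_mulD D l k :
  interleave D (m * l + k) = interleave (fun j i => D j (l + i)%N) k.
Proof. by rewrite /interleave digit_coord_mulD mulnC divnMDl. Qed.

Lemma deinterleaveK c k : interleave (deinterleave c) k = c k.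
Proof.
rewrite /interleave /deinterleave /=.
have km := ltn_pmod k m0.
by rewrite subnSK // subKn ?(ltnW km) // mulnC -divn_eq.
Qed.

Lemma digit_sum_interleave L (D : 'I_m -> nat -> bool) :
  digit_sum q (m * L) (interleave D) = of_coords (fun j => digit_sum Q L (D j)).
Proof.
elim: L => [|L IH].
  rewrite muln0 digit_sum0 /of_coords big1 // => j _.
  by rewrite digit_sum0 rmorph0 mul0r.
have -> : of_coords (fun j => digit_sum Q L.+1 (D j)) =
    of_coords (fun j => digit_sum Q L (D j)) +
    of_coords (fun j => Q ^- L * ((D j L)%:R * Q^-1)).
  rewrite of_coordsD; apply: eq_bigr => j _; congr (_%:C * _).
  by rewrite -addn1 digit_sumD /digit_sum big_ord1 addn0 expr1.
rewrite mulnSr digit_sumD IH -of_coordsZ; congr (_ + _).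
rewrite exprM qm fmorphV rmorphXn; congr (_ * _).
rewrite /digit_sum (reindex_inj rev_ord_inj); apply: eq_bigr => j _ /=.
rewrite interleave_mulD /interleave divn_small ?ltn_subrL ?m0 // addn0.
have -> : digit_coord (m - j.+1) = j.
  apply: val_inj; rewrite /= modn_small ?ltn_subrL // subnSK // subKn //.
  exact: ltnW.
rewrite rmorphM rmorph_nat fmorphV /= -qm -mulrA subnSK //; congr (_ * _).
by rewrite [RHS]mulrC -invf_div -expfB_cond // (negbTE q0) add0n ltnW.
Qed.

Lemma expansion_of_coords c z : expansion q c z ->
  z = of_coords (fun j => digit_value Q (deinterleave c j)).
Proof.
move=> /expansion_unique; apply.
pose C := (Q - 1)^-1 * \sum_(j < m) normc q ^+ j.
apply: (expansion_of_bounded_remainders normc_base_gt1 (C := C)) => n.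
pose tail j := digit_value Q (fun k => deinterleave c j (n + k)%N).
exists (m * n)%N, (of_coords tail); split; first by rewrite leq_pmull.
  apply: normc_of_coords_le => j; have /andP[t0 t1] := digit_value_itv Q1
    (fun k => deinterleave c j (n + k)%N).
  by rewrite ger0_norm.
rewrite -(eq_digit_sum q (fun k _ => deinterleaveK c k)) digit_sum_interleave.
rewrite exprM qm -rmorphXn -fmorphV of_coordsZ of_coordsD.
by apply: eq_bigr => j _; rewrite -digit_value_split.
Qed.

Definition open_box : set R[i] :=
  [set z | exists2 t, (forall j, 0 < t j < 1) & z = of_coords t].

Lemma open_box_bounded z : open_box z -> normc z <= \sum_(j < m) normc q ^+ j.
Proof.
move=> [t t01 ->]; rewrite -[leRHS]mul1r; apply: normc_of_coords_le => j.
by have /andP[t0 t1] := t01 j; rewrite gtr0_norm // ltW.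
Qed.

Lemma expandable_closed_box x : expandable q x ->
  exists2 t, (forall j, 0 <= t j <= 1) & (Q - 1)%:C * x = of_coords t.
Proof.
move=> [c /expansion_of_coords ->]; rewrite of_coordsZ.
exists (fun j => (Q - 1) * digit_value Q (deinterleave c j)) => // j.
have Qm : 0 < Q - 1 by rewrite subr_gt0.
have /andP[v0 v1] := digit_value_itv Q1 (deinterleave c j).
by rewrite mulr_ge0 ?(ltW Qm) //= mulrC -ler_pdivlMr // mul1r.
Qed.

(* Push [z] slightly away from the centre of the box: the result still lies in
   the closed box, so [z] lies in the open one. *)
Lemma interior_expandable_open_box (z : R[i]^o) :
  interior [set ((Q - 1)%:C * x : R[i]^o) | x in expandable q] z -> open_box z.
Proof.
move=> /nbhs_normP[_ /= /gt0_complex[r -> r0] sub].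
pose z0 := of_coords (fun=> 1 / 2); pose la := r / 2 / (1 + normc (z - z0)).
have d0 := normc_ge0 (z - z0).
have la0 : 0 < la by rewrite !divr_gt0 //; lra.
have la_r : la * normc (z - z0) < r.
  by rewrite /la mulrAC ltr_pdivrMr; have := mulr_ge0 (ltW r0) d0; lra.
have [|x /expandable_closed_box[t t01 ->] zE] := sub (z + la%:C * (z - z0)).
  rewrite /ball_ /= opprD addNKr normrN normr_normc ltcR normcM.
  by rewrite normc_real gtr0_norm.
have la1 : 0 < 1 + la by lra.
exists (fun j => (1 + la)^-1 * (t j + la * (1 / 2))) => [j|].
  by have := t01 j; rewrite mulrC ltr_pdivlMr // ltr_pdivrMr //; lra.
rewrite -of_coordsZ -of_coordsD -of_coordsZ -/z0 zE.
have -> : z + la%:C * (z - z0) + la%:C * z0 = (1 + la)%:C * z.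
  by rewrite rmorphD rmorph1; ring.
by rewrite mulrA -rmorphM mulVf ?gt_eqF // mul1r.
Qed.

Lemma open_box_steerable : Q ^+ 4 < 2 -> steerable q open_box.
Proof.
move=> Q42 _ b [t t01 ->]; pose B := (size b).+1.
pose e := deinterleave (nth false b).
have /choice[M0 M0P] (j : 'I_m) := steer_block Q1 Q42 (e j) B (t01 j).
pose M := \max_(j < m) M0 j.
have /choice[d /choice[t' dP]] (j : 'I_m) := M0P j M (@leq_bigmax _ M0 j).
pose w := mkseq (interleave d) (m * (M + B)).
have sw : size w = (m * (M + B))%N by rewrite size_mkseq.
exists w, (of_coords t'); split.
- by exists t' => // j; case: (dP j).
- by rewrite sw muln_gt0 m0 addnS.
- have b_le : (size b <= m * B)%N.
    by rewrite (leq_trans (leqnSn _)) // leq_pmull.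
  have b_drop : (size b <= size (drop (m * M) w))%N.
    by rewrite size_drop sw -mulnBr addKn.
  have <- : take (size b) (drop (m * M) w) = b.
    apply: (@eq_from_nth _ false); rewrite size_takel // => i ib.
    rewrite nth_take // nth_drop.
    rewrite nth_mkseq ?mulnDr ?ltn_add2l ?(leq_trans ib) //.
    rewrite interleave_mulD /interleave; have [_ dE _] := dP (digit_coord i).
    rewrite dE; first exact: deinterleaveK.
    by rewrite ltnS (leq_trans (leq_div _ _)) // ltnW.
  exact: infix_trans (infix_take _ _) (infix_drop _ _).
rewrite /word_value sw (@eq_digit_sum _ q _ _ (interleave d)); last first.
  by move=> k km; rewrite nth_mkseq.
rewrite digit_sum_interleave exprM qm -rmorphXn -fmorphV of_coordsZ of_coordsD.
by apply: eq_bigr => j _; case: (dP j) => _ _ {1}->.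
Qed.

End Grouping.

Theorem theorem5p2 (R : realType) (m : nat) (omega : R[i]) (p : R)
    (hm : (3 <= m)%N) (homega : omega ^+ m = 1)
    (hp1 : 1 < p) (hp2 : p < 2 `^ ((4 * m)%:R^-1))
    (hpisot : ~ second_pisot (p ^+ (2 * m))) :
  let q : R[i] := p%:C * omega in
  forall z : R[i]^o,
    interior [set ((p ^+ m - 1)%:C * x : R[i]^o) | x in expandable q] z ->
    exists c : nat -> bool, expansion q c z /\ universal c.
Proof.
move=> q z; set Q := p ^+ m.
have m0 : (0 < m)%N by exact: ltn_trans hm.
have p0 : 0 < p by exact: lt_trans hp1.
have Q1 : 1 < Q by rewrite exprn_egt1 // -lt0n.
have Q42 : Q ^+ 4 < 2.
  by rewrite -exprM mulnC ltr_expr_powR_inv ?ltW // muln_gt0.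
have qm : q ^+ m = Q%:C by rewrite exprMn homega mulr1 rmorphXn.
have q1 := normc_base_gt1 Q1 qm.
have steer := open_box_steerable m0 Q1 qm Q42.
move=> /(interior_expandable_open_box m0 Q1 qm).
exact: steerable_universal_expansion q1 (@open_box_bounded R m q) steer z.
Qed.
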